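(* Let $p\ge 2$ be an integer for which Hypotheses 1, 2 and 3 (see context) hold, let $N\ge1$, $n\ge1$ and $\zeta\in\mathcal P(E)$. Define the particle error $$\mathcal{E}_{n,N}^{p}(y_{1:n})=\sup_{f:\Vert f\Vert_{\infty}=1}\mathbb{E}_{N}\left(\left|\langle H_{n}^{p}R_{1:n}\zeta-H_{n}^{p}R_{1:n}^{N}\zeta,f\rangle\right|\right),$$ where the supremum is over measurable $f:E^{(n+1)\wedge p}\to\mathbb R$ and $\mathbb{E}_N$ is the expectation over the randomness of the particles only (the observations $y_{1:n}$ being fixed). Then $$\mathcal{E}_{n,N}^{p}(y_{1:n})\leq\frac{4}{\log3}\sum_{i=1}^{n}\frac{\delta_{i}}{\tilde{\varepsilon}_{i+1,p}^{2}\,\tilde{\varepsilon}_{i+p+1,p}^{2}}\prod_{j=2}^{\lfloor(n-i)/p\rfloor-1}\tilde{\rho}_{i+jp+1,p},\qquad \delta_{i}=3\tau^{p}\phi_{i}+\frac{4a_{i}b_{i}}{\sqrt{N}},$$ with the convention that empty products equal one.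
   Context: Setting. $E$ is a complete separable metric space with its Borel $\sigma$-field; $v_{i:j}=(v_i,\ldots,v_j)$; $k^+=k\vee0$; $\mathcal M_+(E^k)$ and $\mathcal P(E^k)$ are the sets of (finite) nonnegative measures and of probability measures on $E^k$; $\langle\mu,f\rangle=\mu(f)=\int f\,d\mu$. $(\Lambda_n)_{n\ge0}$ is an inhomogeneous Markov chain on $E$ with initial law $\zeta$ and transition kernels $Q_n$, $n\ge1$. For $n\ge1$, $\Psi_n:E^{n+1}\to(0,\infty)$ is a measurable potential function; $\Psi_n(\lambda_{0:n})$ is the conditional density at $y_n$ of an observation $Y_n$ given $\Lambda_{0:n}=\lambda_{0:n}$, $Y_{1:n-1}=y_{1:n-1}$, the observed sequence $(y_n)$ being fixed and omitted from the notation. Hypothesis 1: for all $n\ge1$ there are $\varepsilon_n\in(0,1)$ and $\xi\in\mathcal M_+(E)$ with $\varepsilon_n\xi(A)\le Q_n(\lambda,A)\le\varepsilon_n^{-1}\xi(A)$ for all Borel $A\subset E$, $\lambda\in E$. Hypothesis 2 (for the given $p$): for all $n\ge p$ there is a measurable truncated potential $\tilde\Psi_n^p(\lambda_{n-p+1:n})$ depending on the last $p$ states only, with $|\Psi_n(\lambda_{0:n})-\tilde\Psi^p_n(\lambda_{n-p+1:n})|\le\phi_n\tau^p\{\Psi_n(\lambda_{0:n})\wedge\tilde\Psi_n^p(\lambda_{n-p+1:n})\}$ for all $\lambda_{0:n}\in E^{n+1}$, with constants $\phi_n>0$, $0<\tau<1$. For $n<p$, set $\tilde\Psi_n^p=\Psi_n$.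 Hypothesis 3: there are constants $a_n\ge1,b_n\ge1$ with $1/a_n\le\Psi_n(\lambda_{0:n})\le b_n$ and $1/a_n\le\tilde\Psi_n^p(\lambda_{(n-p+1)^+:n})\le b_n$ for all $\lambda_{0:n}\in E^{n+1}$. Operators. For $\mu\in\mathcal M_+(E^n)$, $\gamma_n\mu(f)=\int\mu(d\lambda_{0:n-1})Q_n(\lambda_{n-1},d\lambda_n)\Psi_n(\lambda_{0:n})f(\lambda_{0:n})$, $R_n\mu(f)=\gamma_n\mu(f)/\gamma_n\mu(1)$, and $R_{1:n}\mu=R_n\cdots R_1\mu$ (so $R_{1:n}\zeta$ is the conditional law of $\Lambda_{0:n}$ given $Y_{1:n}=y_{1:n}$). $H_n^p$ maps a measure on $E^{n+1}$ to its marginal on the last $p$ components $\lambda_{n-p+1:n}$ if $n\ge p$, and is the identity if $p>n$. Particle operators. For a probability measure $\mu'$, $S^N(\mu')=\frac1N\sum_{i=1}^N\delta_{Z_i}$ with $Z_1,\dots,Z_N$ i.i.d. of law $\mu'$. Let $\bar Q_n(\lambda_{0:n-1},d\lambda_{0:n}')=\delta_{\lambda_{0:n-1}}(d\lambda'_{0:n-1})Q_n(\lambda_{n-1},d\lambda_n')$ and $\Psi_n\cdot\nu(f)=\nu(\Psi_nf)/\nu(\Psi_n)$. For $\mu\in\mathcal P(E^n)$, $R_n^N\mu=\Psi_n\cdot S^N(\bar Q_n\mu)$, a random weighted empirical measure on $E^{n+1}$. $R_{1:n}^N\zeta=R_n^NR_{n-1}^N\cdots R_1^N\zeta$, where at each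 step the sample is drawn afresh, conditionally independently given the previous steps. Constants: $\tilde\varepsilon_{k,p}^2=\dfrac{\varepsilon_k^2}{(a_k\cdots a_{k+p-2})(b_k\cdots b_{k+p-2})}$, $\tilde\rho_{k,p}=\dfrac{1-\tilde\varepsilon_{k,p}^2}{1+\tilde\varepsilon_{k,p}^2}$. *)

(* Defs.v *)
From HB Require Import structures.
From mathcomp Require Import all_boot all_order all_algebra.
From mathcomp Require Import all_classical all_reals all_analysis.
From mathcomp Require Import measurable_realfun.

Set Implicit Arguments.
Unset Strict Implicit.
Unset Printing Implicit Defensive.

Import Order.TTheory GRing.Theory Num.Theory.
Import numFieldNormedType.Exports.

Local Open Scope classical_set_scope.
Local Open Scope ring_scope.
Local Open Scope ereal_scope.

#[short(type="completeMetricType")]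
HB.structure Definition CompleteMetric (R : numDomainType) :=
  {T of Metric R T & Complete T}.

Definition separable_space (T : topologicalType) :=
  exists2 D : set T, countable D & dense D.

(* [E] with its Borel sigma-algebra. The tuples [k.-tuple (borel E)] below carry
   the product sigma-algebra, which is the Borel one of [E^k] when [E] is
   separable. *)
Definition borel (R : realType) (E : completeMetricType R) :
  measurableType (@open E).-sigma := g_sigma_algebraType (@open E).

Section tuples.
Context d (T : measurableType d).

Definition tuple_single (x : T) : 1.-tuple T := [tuple x].

Definition tuple_cons n (xt : T * n.-tuple T) : n.+1.-tuple T :=
  [tuple of xt.1 :: xt.2].

Definition tuple_rcons n (tx : n.-tuple T * T) : n.+1.-tuple T :=
  [tuple of rcons tx.1 tx.2].

Definition tuple_last n (t : n.+1.-tuple T) : T := tnth t ord_max.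

Fact tail_subproof m k (i : 'I_(minn m k)) : (m - minn m k + i < m)%N.
Proof.
by rewrite -[X in (_ < X)%N](subnK (geq_minl m k)) ltn_add2l.
Qed.

(* the last [k] components of [t], or [t] itself (up to the equality
   [minn m k = m]) when [m <= k] *)
Definition tuple_tail m k (t : m.-tuple T) : (minn m k).-tuple T :=
  [tuple tnth t (Ordinal (tail_subproof i)) | i < minn m k].

Lemma measurable_tuple_single : measurable_fun [set: T] tuple_single.
Proof.
apply/measurable_fun_tnthP => i.
rewrite (_ : _ \o _ = id); first exact: measurable_id.
by apply/funext => x /=; rewrite ord1.
Qed.
HB.instance Definition _ :=
  isMeasurableFun.Build _ _ _ _ tuple_single measurable_tuple_single.

Lemma measurable_tuple_cons n :
  measurable_fun [set: T * n.-tuple T] (@tuple_cons n).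
Proof. exact: measurable_cons. Qed.
HB.instance Definition _ n :=
  isMeasurableFun.Build _ _ _ _ (@tuple_cons n) (@measurable_tuple_cons n).

Lemma measurable_tuple_rcons n :
  measurable_fun [set: n.-tuple T * T] (@tuple_rcons n).
Proof.
apply/measurable_fun_tnthP => i.
have [ni|ni] := ltnP i n.
  rewrite (_ : _ \o _ = (fun t => tnth t (Ordinal ni)) \o fst).
    exact: measurableT_comp (measurable_tnth _) measurable_fst.
  apply/funext => -[t x] /=; rewrite !(tnth_nth x) /= nth_rcons size_tuple.
  by rewrite ni.
rewrite (_ : _ \o _ = snd); first exact: measurable_snd.
apply/funext => -[t x] /=; rewrite !(tnth_nth x) /= nth_rcons size_tuple.
have -> : (i : nat) = n by apply/eqP; rewrite eqn_leq ni -ltnS ltn_ord.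
by rewrite ltnn eqxx.
Qed.
HB.instance Definition _ n :=
  isMeasurableFun.Build _ _ _ _ (@tuple_rcons n) (@measurable_tuple_rcons n).

Lemma measurable_tuple_last n :
  measurable_fun [set: n.+1.-tuple T] (@tuple_last n).
Proof. exact: measurable_tnth. Qed.

Lemma measurable_tuple_tail m k :
  measurable_fun [set: m.-tuple T] (@tuple_tail m k).
Proof.
apply/measurable_fun_tnthP => i.
rewrite (_ : _ \o _ = (fun t => tnth t (Ordinal (tail_subproof i)))).
  exact: measurable_tnth.
by apply/funext => t /=; rewrite tnth_mktuple.
Qed.
HB.instance Definition _ m k :=
  isMeasurableFun.Build _ _ _ _ (@tuple_tail m k) (@measurable_tuple_tail m k).

End tuples.

(* The measure [mu k : A |-> int mu(dx) k(x, A)] for a kernel [k]. *)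
Section kernel_action.
Context d d' (X : measurableType d) (Y : measurableType d') (R : realType).

Definition kact (mu : {measure set X -> \bar R}) (k : R.-ker X ~> Y)
  (A : set Y) : \bar R := \int[mu]_x k x A.

Section measure.
Variables (mu : {measure set X -> \bar R}) (k : R.-ker X ~> Y).

Let kact0 : kact mu k set0 = 0.
Proof. by apply: integral0_eq => x _; rewrite measure0. Qed.

Let kact_ge0 A : 0 <= kact mu k A.
Proof. by apply: integral_ge0. Qed.

Let kact_sigma_additive : semi_sigma_additive (kact mu k).
Proof.
move=> F mF tF mUF; rewrite [X in _ --> X](_ : _ =
  \int[mu]_x (\sum_(n <oo) k x (F n))); last first.
  apply: eq_integral => x _.
  by apply/esym/cvg_lim => //; exact/measure_semi_sigma_additive.
apply/cvg_closeP; split.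
  by apply: is_cvg_nneseries => n _ _; exact: integral_ge0.
rewrite closeE// integral_nneseries// => n.
exact: measurable_kernel k _ (mF n).
Qed.

HB.instance Definition _ := isMeasure.Build _ _ _ (kact mu k)
  kact0 kact_ge0 kact_sigma_additive.
End measure.

Section probability.
Variables (mu : probability X R) (k : R.-pker X ~> Y).

Let kact_setT : kact mu k [set: Y] = 1.
Proof.
rewrite /kact (eq_integral (cst 1)); last by move=> x _; rewrite prob_kernel.
by rewrite integral_cst// mul1e; exact: probability_setT.
Qed.

HB.instance Definition _ := Measure_isProbability.Build _ _ _
  (kact mu k) kact_setT.
End probability.

End kernel_action.

Record potential d (T : measurableType d) (R : realType) := Potential {
  potential_fun :> T -> R ;
  measurable_potential : measurable_fun [set: T] potential_fun ;
  potential_gt0 : forall x, (0 < potential_fun x)%R }.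

(* The measure [Psi d nu] and its normalization [Psi . nu].  The second argument
   of [mnormalize] is a junk value, used only if [nu(Psi)] is [0] or [+oo]. *)
Section boltzmann_gibbs.
Context d (T : measurableType d) (R : realType).
Variables (Psi : potential T R) (nu : {measure set T -> \bar R}).

Definition mweight (A : set T) : \bar R := \int[nu]_(x in A) (Psi x)%:E.

Let Psi_ge0 x : 0 <= (Psi x)%:E.
Proof. by rewrite lee_fin ltW// potential_gt0. Qed.

Let mweight0 : mweight set0 = 0. Proof. exact: integral_set0. Qed.

Let mweight_ge0 A : 0 <= mweight A.
Proof. by apply: integral_ge0 => x _; exact: Psi_ge0. Qed.

Let mweight_sigma_additive : semi_sigma_additive mweight.
Proof.
apply: semi_sigma_additive_nng_induced; last exact: Psi_ge0.
by apply/measurable_EFinP; exact: measurable_potential.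
Qed.

HB.instance Definition _ := isMeasure.Build _ _ _ mweight
  mweight0 mweight_ge0 mweight_sigma_additive.

Definition boltzmann_gibbs : probability T R := mnormalize mweight point.

End boltzmann_gibbs.

Section iid.
Context d (T : measurableType d) (R : realType).

(* the law of [N] independent variables with law [nu] *)
Fixpoint iid (nu : probability T R) (N : nat) : probability (N.-tuple T) R :=
  match N with
  | 0 => dirac [tuple]
  | N'.+1 => distribution (nu \x iid nu N') (@tuple_cons _ T N')
  end.

(* [N^-1 * sum_(i < N) delta_(z_i)]; the default of [nth] is never used *)
Definition empirical N (z : N.-tuple T) : {measure set T -> \bar R} :=
  mscale ((N%:R : R)^-1%:nng)%R (msum (fun i => dirac (nth point z i)) N).

End iid.


Section iid_measurable.
Context d d' (X : measurableType d) (T : measurableType d') (R : realType).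
Variable k : X -> probability T R.
Hypothesis mk : forall A, measurable A -> measurable_fun [set: X] (k ^~ A).

Lemma measurable_fun_iid N (A : set (N.-tuple T)) : measurable A ->
  measurable_fun [set: X] (fun x => iid (k x) N A).
Proof.
elim: N A => [|N IH] A mA /=; first exact: measurable_cst.
pose l (x : X) : {measure set T -> \bar R} := k x.
pose Hl := isKernel.Build _ _ X T R l mk.
pose Hl1 := Kernel_isProbability.Build _ _ X T R (HB.pack_for (kernel X T R) l Hl)
  (fun x => probability_setT (k x)).
pose lK := HB.pack_for (R.-pker X ~> T) l Hl Hl1.
pose m (xy : X * T) : {measure set (N.-tuple T) -> \bar R} := iid (k xy.1) N.
have mm U : measurable U -> measurable_fun [set: X * T] (m ^~ U).
  move=> mU; rewrite /m.
  exact: (measurableT_comp (IH U mU) measurable_fst).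
pose Hm := isKernel.Build _ _ (X * T)%type (N.-tuple T) R m mm.
pose Hm1 := Kernel_isProbability.Build _ _ (X * T)%type (N.-tuple T) R
  (HB.pack_for (kernel (X * T)%type (N.-tuple T) R) m Hm)
  (fun xy => probability_setT (iid (k xy.1) N)).
pose mK := HB.pack_for (R.-pker (X * T)%type ~> (N.-tuple T)) m Hm Hm1.
pose B := @tuple_cons _ T N @^-1` A.
have mB : measurable B.
  by rewrite -[B]setTI; exact: measurable_tuple_cons.
pose C := [set xyt : (X * T) * N.-tuple T | B (xyt.1.2, xyt.2)].
have mC : measurable C.
  rewrite -[C]setTI.
  have mf : measurable_fun [set: (X * T) * N.-tuple T]
      (fun xyt => (xyt.1.2, xyt.2)).
    apply/measurable_fun_pairP; split.
      exact: (measurableT_comp measurable_snd measurable_fst).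
    exact: measurable_snd.
  exact: mf.
have mh : measurable_fun [set: X * T] (fun xy => mK xy (xsection C xy)).
  by apply: measurable_fun_xsection_finite_kernel; rewrite inE.
have := measurable_fun_integral_finite_kernel _ lK _ mh.
move=> /(_ (fun=> measure_ge0 _ _)).
apply: eq_measurable_fun => x _.
rewrite /distribution /pushforward /product_measure1 /=.
apply: eq_integral => y _.
by congr (iid _ _ _); apply/seteqP; split => t; rewrite /xsection/= !inE.
Qed.

End iid_measurable.

Section path_kernel.
Context d (E : measurableType d) (R : realType) (q : R.-pker E ~> E) (n : nat).

Let rcons_at (t : n.+1.-tuple E) (x : E) := tuple_rcons (t, x).

Let measurable_rcons_at t : measurable_fun [set: E] (rcons_at t).
Proof.
exact: (measurableT_comp (@measurable_tuple_rcons _ _ n.+1) (pair1_measurable t)).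
Qed.
HB.instance Definition _ t :=
  isMeasurableFun.Build _ _ _ _ (rcons_at t) (measurable_rcons_at t).

(* The kernel [delta_t(dt') q(tuple_last t, dx)] from [E^(n+1)] to [E^(n+2)]. *)
Definition path_kernel_at (t : n.+1.-tuple E) : set (n.+2.-tuple E) -> \bar R :=
  pushforward (q (tuple_last t)) (fun x => tuple_rcons (t, x)).

Let path_kernel0 t : path_kernel_at t set0 = 0.
Proof. exact: (measure0 (pushforward (q (tuple_last t)) (rcons_at t))). Qed.

Let path_kernel_ge0 t A : 0 <= path_kernel_at t A.
Proof. exact: (measure_ge0 (pushforward (q (tuple_last t)) (rcons_at t))). Qed.

Let path_kernel_sigma_additive t : semi_sigma_additive (path_kernel_at t).
Proof.
exact: (@measure_semi_sigma_additive _ _ _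
  (pushforward (q (tuple_last t)) (rcons_at t))).
Qed.

HB.instance Definition _ t := isMeasure.Build _ _ _ (path_kernel_at t)
  (path_kernel0 t) (path_kernel_ge0 t) (@path_kernel_sigma_additive t).

Definition path_kernel (t : n.+1.-tuple E) :
  {measure set (n.+2.-tuple E) -> \bar R} := path_kernel_at t.

Let measurable_path_kernel A : measurable A ->
  measurable_fun [set: n.+1.-tuple E] (path_kernel ^~ A).
Proof.
move=> mA.
pose l (t : n.+1.-tuple E) : {measure set E -> \bar R} := q (tuple_last t).
have ml U : measurable U -> measurable_fun [set: n.+1.-tuple E] (l ^~ U).
  move=> mU; apply: (measurableT_comp (measurable_kernel q U mU)).
  exact: measurable_tuple_last.
pose Hl := isKernel.Build _ _ (n.+1.-tuple E) E R l ml.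
pose Hl1 := Kernel_isProbability.Build _ _ (n.+1.-tuple E) E R
  (HB.pack_for (kernel (n.+1.-tuple E) E R) l Hl)
  (fun t => prob_kernel (tuple_last t)).
pose lK := HB.pack_for (R.-pker (n.+1.-tuple E) ~> E) l Hl Hl1.
pose B := @tuple_rcons _ E n.+1 @^-1` A.
have mB : measurable B.
  by rewrite -[B]setTI; exact: measurable_tuple_rcons.
have BT : B \in measurable by rewrite inE.
apply: eq_measurable_fun (measurable_fun_xsection_finite_kernel lK BT) => t _.
by rewrite /= /path_kernel_at /pushforward /l; congr (q _ _); apply/seteqP;
  split => x; rewrite /xsection/= !inE.
Qed.

HB.instance Definition _ :=
  isKernel.Build _ _ _ _ R path_kernel measurable_path_kernel.

Let path_kernel_setT t : path_kernel t [set: _] = 1.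
Proof. exact: (prob_kernel (tuple_last t)). Qed.

HB.instance Definition _ :=
  Kernel_isProbability.Build _ _ _ _ R path_kernel path_kernel_setT.

End path_kernel.
Arguments path_kernel {d E R} q n t.

Section boltzmann_gibbs_empirical.
Context d (T : measurableType d) (R : realType).

Definition weighted_empirical (Psi : potential T R) N (z : N.-tuple T) :
  pprobability T R := boltzmann_gibbs Psi (empirical R z).

Lemma measurable_empirical N (A : set T) : measurable A ->
  measurable_fun [set: N.-tuple T] (fun z => empirical R z A).
Proof.
move=> mA; rewrite /empirical/= /mscale/= /msum/=.
apply: measurable_funeM; apply: emeasurable_sum => i.
rewrite (_ : (fun z : N.-tuple T => _) =
    (fun z => \d_(tnth z i) A : \bar R)); last first.
  by apply/funext => z; rewrite -tnth_nth.
exact: (measurableT_comp (measurable_fun_dirac mA) (measurable_tnth i)).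
Qed.

Lemma measurable_weighted_empirical (Psi : potential T R) N :
  measurable_fun [set: N.-tuple T] (@weighted_empirical Psi N).
Proof.
pose k (z : N.-tuple T) : {measure set T -> \bar R} :=
  mweight Psi (empirical R z).
have mk A : measurable A -> measurable_fun [set: N.-tuple T] (k ^~ A).
  move=> mA; rewrite /k /= /mweight.
  apply: (eq_measurable_fun
    (fun z => \int[empirical R z]_x ((\1_A x)%:E * (Psi x)%:E))) => [z _|].
    rewrite [RHS]integral_mkcond; apply: eq_integral => x _.
    rewrite patchE indicE; case: (x \in A); first by rewrite mul1e.
    by rewrite mul0e.
  apply: (measurable_fun_integral_kernel (l := fun z => empirical R z)).
  - by move=> U mU; exact: measurable_empirical.
  - by move=> x; rewrite mule_ge0// lee_fin ?ltW ?potential_gt0.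
  - apply: emeasurable_funM.
      by apply/measurable_EFinP; exact: measurable_indic.
    by apply/measurable_EFinP; exact: measurable_potential.
pose Hk := isKernel.Build _ _ (N.-tuple T) T R k mk.
pose kK := HB.pack_for (kernel (N.-tuple T) T R) k Hk.
exact: (measurable_fun_mnormalize kK).
Qed.

HB.instance Definition _ (Psi : potential T R) N :=
  isMeasurableFun.Build _ _ _ _ (@weighted_empirical Psi N)
    (@measurable_weighted_empirical Psi N).

End boltzmann_gibbs_empirical.

Lemma measurable_pprobability_eval d (T : measurableType d) (R : realType)
    (A : set T) : measurable A ->
  measurable_fun [set: pprobability T R] (fun mu : probability T R => mu A).
Proof.
move=> mA.
exact: (measurable_kernel (@kprobability _ _ (pprobability T R) T R id
  (@measurable_id _ _ _)) A mA).
Qed.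

Section particle_kernel.
Context d (E : measurableType d) (R : realType) (q : R.-pker E ~> E) (n : nat).
Variables (Psi : potential (n.+2.-tuple E) R) (N : nat).

(* The law of the random measure [Psi . S^N (mu (path_kernel q n))], where [S^N]
   draws [N] independent particles: one random step of the particle filter, seen
   as a Markov kernel between spaces of probability measures. *)
Definition particle_kernel (mu : pprobability (n.+1.-tuple E) R) :
    {measure set (pprobability (n.+2.-tuple E) R) -> \bar R} :=
  distribution (iid (kact (mu : probability _ R) (path_kernel q n)) N)
    (@weighted_empirical _ _ R Psi N).

Let measurable_particle_kernel A : measurable A ->
  measurable_fun [set: pprobability (n.+1.-tuple E) R] (particle_kernel ^~ A).
Proof.
move=> mA; rewrite /particle_kernel /= /distribution /pushforward /=.
apply: (measurable_fun_iid (k := fun mu : pprobability (n.+1.-tuple E) R =>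
  kact (mu : probability _ R) (path_kernel q n))).
  move=> B mB; rewrite /kact.
  apply: (measurable_fun_integral_kernel
    (l := fun mu : pprobability (n.+1.-tuple E) R => (mu : probability _ R))).
  - by move=> U mU; exact: measurable_pprobability_eval.
  - by [].
  - exact: (measurable_kernel (path_kernel q n) B mB).
by rewrite -[X in measurable X]setTI; exact: measurable_weighted_empirical.
Qed.

HB.instance Definition _ :=
  isKernel.Build _ _ _ _ R particle_kernel measurable_particle_kernel.

Let particle_kernel_setT mu : particle_kernel mu [set: _] = 1.
Proof. exact: probability_setT. Qed.

HB.instance Definition _ :=
  Kernel_isProbability.Build _ _ _ _ R particle_kernel particle_kernel_setT.

End particle_kernel.

(* A path [(x_0, ..., x_n)] is a tuple of size [n.+1]; the step from time [n] to
   time [n.+1] uses [Q n.+1] and [Psi n.+1], and [Q 0], [Psi 0] are never used. *)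
Section filters.
Context d (E : measurableType d) (R : realType).
Variables (Q : nat -> R.-pker E ~> E) (zeta : probability E R).
Variable Psi : forall n, potential (n.+1.-tuple E) R.

Definition gamma_step n (mu : {measure set (n.+1.-tuple E) -> \bar R}) :
    {measure set (n.+2.-tuple E) -> \bar R} :=
  mweight (Psi n.+1) (kact mu (path_kernel (Q n.+1) n)).

Definition filter_step n (mu : {measure set (n.+1.-tuple E) -> \bar R}) :
    probability (n.+2.-tuple E) R :=
  mnormalize (gamma_step mu) point.

Fixpoint optimal_filter n : probability (n.+1.-tuple E) R :=
  match n with
  | 0 => distribution zeta (@tuple_single _ E)
  | m.+1 => filter_step (optimal_filter m)
  end.

(* The law of the random measure [R^N_n ... R^N_1 zeta]: the particles of each
   step are drawn conditionally on the previous steps, which they depend on only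
   through the current random measure. *)
Fixpoint particle_law N n : probability (pprobability (n.+1.-tuple E) R) R :=
  match n with
  | 0 => dirac (distribution zeta (@tuple_single _ E) : pprobability _ R)
  | m.+1 => kact (particle_law N m) (particle_kernel (Q m.+1) (Psi m.+1) N)
  end.

(* The marginal on the last [p] components, on all of them if [n < p]. *)
Definition marginal p n (mu : probability (n.+1.-tuple E) R) :
    probability ((minn n.+1 p).-tuple E) R :=
  distribution mu (@tuple_tail _ E n.+1 p).

(* The outer integral is the expectation over the particles; the norm of [f] is
   the (everywhere) supremum of [|f|]. *)
Definition particle_error N p n : \bar R :=
  ereal_sup [set
    \int[particle_law N n]_mu
       `| \int[marginal p (optimal_filter n)]_x (f x)%:E
          - \int[marginal p (mu : probability (n.+1.-tuple E) R)]_x (f x)%:E |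
    | f in [set f : (minn n.+1 p).-tuple E -> R |
        measurable_fun [set: (minn n.+1 p).-tuple E] f /\
        ereal_sup (range (fun x => `|f x|%:E)) = 1 ] ].

End filters.

Local Open Scope ring_scope.

Section hypotheses.
Context d (E : measurableType d) (R : realType).

Definition mixing (Q : nat -> R.-pker E ~> E) (eps : nat -> R) :=
  forall n, (1 <= n)%N -> 0 < eps n < 1 /\
    exists xi : {finite_measure set E -> \bar R},
      forall (x : E) (A : set E), measurable A ->
        ((eps n)%:E * xi A <= Q n x A)%E /\
        (Q n x A <= ((eps n)^-1)%:E * xi A)%E.

(* [Psit n] takes the last [minn n.+1 p] states of a path of [n.+1] states: the
   last [p] ones if [p <= n], all of them if [n < p]. The sequence [phi] is
   assumed positive at all times [n >= 1], as [local_error] uses it for [n < p]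
   too. *)
Definition truncated_potentials (p : nat)
    (Psi : forall n, potential (n.+1.-tuple E) R)
    (Psit : forall n, (minn n.+1 p).-tuple E -> R) (phi : nat -> R) (tau : R) :=
  [/\ 0 < tau < 1,
      forall n, (1 <= n)%N -> 0 < phi n,
      forall n, (1 <= n < p)%N -> forall t : n.+1.-tuple E,
        Psit n (tuple_tail p t) = Psi n t
    & forall n, (p <= n)%N ->
        measurable_fun [set: (minn n.+1 p).-tuple E] (Psit n) /\
        forall t : n.+1.-tuple E,
          `|Psi n t - Psit n (tuple_tail p t)| <=
          phi n * tau ^+ p * Num.min (Psi n t) (Psit n (tuple_tail p t))].

Definition bounded_potentials (p : nat)
    (Psi : forall n, potential (n.+1.-tuple E) R)
    (Psit : forall n, (minn n.+1 p).-tuple E -> R) (a b : nat -> R) :=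
  forall n, (1 <= n)%N -> [/\ 1 <= a n, 1 <= b n &
    forall t : n.+1.-tuple E,
      (a n)^-1 <= Psi n t <= b n /\
      (a n)^-1 <= Psit n (tuple_tail p t) <= b n].

(* the square of [eps_tilde] *)
Definition eps_tilde2 (eps a b : nat -> R) (k p : nat) : R :=
  eps k ^+ 2 /
  (\prod_(k <= l < k + p - 1) a l * \prod_(k <= l < k + p - 1) b l).

Definition rho_tilde (eps a b : nat -> R) (k p : nat) : R :=
  (1 - eps_tilde2 eps a b k p) / (1 + eps_tilde2 eps a b k p).

Definition local_error (a b phi : nat -> R) (tau : R) (N p i : nat) : R :=
  3 * tau ^+ p * phi i + 4 * a i * b i / Num.sqrt N%:R.

End hypotheses.

(* Main.v *)
Require Import Defs.
From mathcomp Require Import all_boot all_order all_algebra.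
From mathcomp Require Import all_classical all_reals all_analysis.
From mathcomp Require Import measurable_realfun.
From mathcomp Require Import ring lra.

Set Implicit Arguments.
Unset Strict Implicit.
Unset Printing Implicit Defensive.

Import Order.TTheory GRing.Theory Num.Theory.

Local Open Scope classical_set_scope.
Local Open Scope ring_scope.

(* Let [U_k] and [V_k] be the integrals of [1] and of the test function against
   the product of the truncated potentials after time [k], as functions of the
   path up to time [k]. The ratio [Phi_k mu = mu V_k / mu U_k] is invariant under
   the truncated filter recursion and [Phi_n mu] is the mean of the test function,
   so for the true filter and for the particle filter alike the error telescopes
   into the differences of [Phi_i] between the true (or sampled) and the truncated
   step [i].

   A block of [p] truncated steps maps nonnegative functions of the last [p]
   states to functions whose values differ at most by a factor
   [kappa = 1 / eps_tilde2]. Bounding an odds ratio, the block contracts the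
   oscillation of [V / U] by [(kappa - 1) / (kappa + 1) = rho_tilde], which is
   Birkhoff's constant obtained without the Hilbert metric. Hence
   [|V_i - al U_i| <= r U_i] with [r] a product of such factors, and each local
   difference is at most [r] times a truncation error [2 phi tau^p] plus a
   Monte Carlo error [2 kappa a b / sqrt N]. The stated bound is weaker since
   [ln 3 <= 2] and all [eps_tilde2 <= 1]. *)

(** * Integration against a mixture of measures *)

Section mixture.
Local Open Scope ereal_scope.
Context d d' (X : measurableType d) (Y : measurableType d') (R : realType).
Variables (mu : {measure set X -> \bar R}) (m : {measure set Y -> \bar R}).
Variable k : X -> {measure set Y -> \bar R}.
Hypothesis mk : forall A, measurable A -> measurable_fun [set: X] (k ^~ A).
Hypothesis mE : forall A, measurable A -> m A = \int[mu]_x k x A.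

Import HBNNSimple.

Lemma integral_mixture_nnsfun (h : {nnsfun Y >-> R}) :
  \int[m]_y (h y)%:E = \int[mu]_x \int[k x]_y (h y)%:E.
Proof.
have mh (r : R) : measurable (h @^-1` [set r]) by exact: measurable_funPTI.
under [RHS]eq_integral do rewrite integralT_nnsfun sintegralE.
rewrite ge0_integral_fsum//; first last.
- move=> r x _.
  have [r0|r0] := leP 0%R r; first by rewrite mule_ge0// lee_fin.
  by rewrite preimage_nnfun0// measure0 mule0.
- by move=> r; apply: measurable_funeM; exact: mk.
rewrite integralT_nnsfun sintegralE; apply: eq_fsbigr => r _.
have [r0|r0] := leP 0%R r; first by rewrite ge0_integralZl// ?mE//; exact: mk.
rewrite preimage_nnfun0// measure0 mule0 integral0_eq// => x _.
by rewrite measure0 mule0.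
Qed.

(** Simple functions and monotone convergence, applied to [m] and to each [k x]. The [k x] need not
    have mass one, so that reweighting can also be treated as a mixture. *)
Lemma ge0_integral_mixture (f : Y -> \bar R) :
  (forall y, 0 <= f y) -> measurable_fun [set: Y] f ->
  \int[m]_y f y = \int[mu]_x \int[k x]_y f y.
Proof.
move=> f0 mf; pose g := nnsfun_approx measurableT mf.
have mg n : measurable_fun [set: Y] (EFin \o g n) by exact/measurable_EFinP.
have g0 n y : 0 <= (g n y)%:E by rewrite lee_fin.
have ndg y : nondecreasing_seq (fun n => (g n y)%:E).
  by move=> a b ab; rewrite lee_fin; exact/lefP/nd_nnsfun_approx.
have limg (P : {measure set Y -> \bar R}) :
    \int[P]_y f y = limn (fun n => \int[P]_y (g n y)%:E).
  rewrite -monotone_convergence//.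
  by apply: eq_integral => y _; apply/esym/cvg_lim => //; exact: cvg_nnsfun_approx.
rewrite limg; under eq_fun do rewrite integral_mixture_nnsfun.
rewrite -monotone_convergence//.
- by apply: eq_integral => x _; rewrite limg.
- by move=> n; exact: (measurable_fun_integral_kernel mk (g0 n) (mg n)).
- by move=> n x _; exact: integral_ge0.
- move=> x _ a b ab; apply: ge0_le_integral => //; [exact: mg|exact: mg|].
  by move=> y _; exact: ndg.
Qed.

End mixture.

(** * Bounded measurable functions and their means *)

Section bounded_measurable.
Context d (T : measurableType d) (R : realType).
Implicit Types f g : T -> R.

Definition bmeas f :=
  measurable_fun [set: T] f /\ exists M : R, forall x, `|f x| <= M.

Lemma bmeas_cst c : bmeas (fun=> c).
Proof. by split; [exact: measurable_cst|exists `|c|]. Qed.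

Lemma bmeasD f g : bmeas f -> bmeas g -> bmeas (fun x => f x + g x).
Proof.
move=> [mf [M fM]] [mg [M' gM']]; split; first exact: measurable_funD.
by exists (M + M') => x; rewrite (le_trans (ler_normD _ _))// lerD.
Qed.

Lemma bmeasM f g : bmeas f -> bmeas g -> bmeas (fun x => f x * g x).
Proof.
move=> [mf [M fM]] [mg [M' gM']]; split; first exact: measurable_funM.
by exists (M * M') => x; rewrite normrM ler_pM.
Qed.

Lemma bmeasZ c f : bmeas f -> bmeas (fun x => c * f x).
Proof. by move=> bf; apply: bmeasM => //; exact: bmeas_cst. Qed.

Lemma bmeasB f g : bmeas f -> bmeas g -> bmeas (fun x => f x - g x).
Proof.
move=> bf bg; under eq_fun do rewrite -mulN1r.
by apply: bmeasD => //; exact: bmeasZ.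
Qed.

Lemma bmeas_norm f : bmeas f -> bmeas (fun x => `|f x|).
Proof.
move=> [mf [M fM]]; split; first exact: measurableT_comp.
by exists M => x; rewrite normr_id.
Qed.

End bounded_measurable.

Lemma bmeas_comp d d' (T : measurableType d) (U : measurableType d')
    (R : realType) (h : U -> T) (f : T -> R) :
  measurable_fun [set: U] h -> bmeas f -> bmeas (fun x => f (h x)).
Proof.
move=> mh [mf [M fM]]; split; first exact: measurableT_comp.
by exists M => x; exact: fM.
Qed.

(* The measures are required to have mass one instead of being of type
   [probability], because empirical measures do not have that type. *)
Section mean.
Context d (T : measurableType d) (R : realType).
Variable mu : {measure set T -> \bar R}.
Hypothesis mu1 : mu [set: T] = 1%E.
Implicit Types f g : T -> R.

Lemma bmeas_integrable f : bmeas f -> mu.-integrable [set: T] (EFin \o f).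
Proof.
move=> [mf [M fM]]; apply: measurable_bounded_integrable => //.
  by rewrite mu1 ltry.
exists M; split; first exact: num_real.
by move=> r Mr x _ /=; exact: le_trans (fM x) (ltW Mr).
Qed.

Lemma EFin_mean f : bmeas f -> (\int[mu]_x f x)%:E = (\int[mu]_x (f x)%:E)%E.
Proof.
by move=> /bmeas_integrable fi; rewrite fineK//; exact: integrable_fin_num.
Qed.

Lemma mean_cst c : \int[mu]_x c = c.
Proof. by rewrite Rintegral_cst// mu1 mulr1. Qed.

Lemma meanD f g : bmeas f -> bmeas g ->
  \int[mu]_x (f x + g x) = \int[mu]_x f x + \int[mu]_x g x.
Proof. by move=> bf bg; rewrite RintegralD//; exact: bmeas_integrable. Qed.

Lemma meanB f g : bmeas f -> bmeas g ->
  \int[mu]_x (f x - g x) = \int[mu]_x f x - \int[mu]_x g x.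
Proof. by move=> bf bg; rewrite RintegralB//; exact: bmeas_integrable. Qed.

Lemma meanZ c f : bmeas f -> \int[mu]_x (c * f x) = c * \int[mu]_x f x.
Proof. by move=> bf; rewrite RintegralZl//; exact: bmeas_integrable. Qed.

Lemma le_mean f g : bmeas f -> bmeas g -> (forall x, f x <= g x) ->
  \int[mu]_x f x <= \int[mu]_x g x.
Proof. by move=> bf bg fg; apply: le_Rintegral => //; exact: bmeas_integrable. Qed.

Lemma mean_bound f M : bmeas f -> (forall x, `|f x| <= M) ->
  `|\int[mu]_x f x| <= M.
Proof.
move=> bf fM; rewrite (le_trans (le_normr_Rintegral _ (bmeas_integrable bf)))//.
by rewrite -[leRHS]mean_cst le_mean//; [exact: bmeas_norm|exact: bmeas_cst].
Qed.

Lemma norm_mean_le f g : bmeas f -> bmeas g -> (forall x, `|f x| <= g x) ->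
  `|\int[mu]_x f x| <= \int[mu]_x g x.
Proof.
move=> bf bg fg; rewrite (le_trans (le_normr_Rintegral _ (bmeas_integrable bf)))//.
by rewrite le_mean//; exact: bmeas_norm.
Qed.

End mean.

Section mean_unique.
Context d (T : measurableType d) (R : realType).
Variables (m : {measure set T -> \bar R}) (L : (T -> R) -> R).
Hypothesis m1 : m [set: T] = 1%E.

(** A bounded function becomes nonnegative when its bound is added, and both sides shift by that
    constant. Formulas obtained by Tonelli or monotone convergence thus extend to signed
    functions. *)
Lemma mean_unique :
  (forall f, bmeas f -> (forall x, 0 <= f x) ->
    (\int[m]_x (f x)%:E = (L f)%:E)%E) ->
  (forall f c, bmeas f -> L (fun x => f x + c) = L f + c) ->
  forall f, bmeas f -> \int[m]_x f x = L f.
Proof.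
move=> L_ge0 LD f bf; have [mf [M fM]] := bf.
apply: (addIr M); rewrite -LD// -[X in _ + X = _](mean_cst m1) -meanD//; last first.
  exact: bmeas_cst.
have bfM : bmeas (fun y => f y + M) by apply: bmeasD => //; exact: bmeas_cst.
apply: EFin_inj; rewrite EFin_mean// L_ge0// => x.
by rewrite -lerBlDr sub0r; have := fM x; rewrite ler_norml => /andP[].
Qed.

End mean_unique.

Section mean_mixture.
Context d d' (X : measurableType d) (Y : measurableType d') (R : realType).

Lemma bmeas_mean (k : X -> {measure set Y -> \bar R}) (f : Y -> R) :
  (forall A, measurable A -> measurable_fun [set: X] (k ^~ A)) ->
  (forall x, k x [set: Y] = 1%E) ->
  bmeas f -> bmeas (fun x => \int[k x]_y f y).
Proof.
move=> mk k1 bf; have [mf [M fM]] := bf; split; last first.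
  by exists M => x; exact: mean_bound.
have bfM : bmeas (fun y => f y + M) by apply: bmeasD => //; exact: bmeas_cst.
(* The shift by [M] reduces measurability in [x] to nonnegative integrands. *)
have -> : (fun x => \int[k x]_y f y) = (fun x => \int[k x]_y (f y + M) - M).
  apply/funext => x; rewrite meanD//; last exact: bmeas_cst.
  by rewrite mean_cst// addrK.
apply: measurable_funB => //; apply/measurable_EFinP.
rewrite (_ : _ \o _ = fun x => \int[k x]_y (f y + M)%:E)%E; last first.
  by apply/funext => x /=; rewrite EFin_mean.
apply: measurable_fun_integral_kernel => //.
  by move=> y; rewrite lee_fin -lerBlDr sub0r; have := fM y; rewrite ler_norml => /andP[].
by apply/measurable_EFinP; exact: bfM.1.
Qed.

Lemma mean_mixture (mu : {measure set X -> \bar R})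
    (m : {measure set Y -> \bar R}) (k : X -> {measure set Y -> \bar R})
    (f : Y -> R) :
  mu [set: X] = 1%E -> (forall x, k x [set: Y] = 1%E) ->
  (forall A, measurable A -> measurable_fun [set: X] (k ^~ A)) ->
  (forall A, measurable A -> m A = \int[mu]_x k x A)%E ->
  bmeas f ->
  \int[m]_y f y = \int[mu]_x \int[k x]_y f y.
Proof.
move=> mu1 k1 mk mE; have bk g := @bmeas_mean k g mk k1.
pose L (g : Y -> R) := \int[mu]_x \int[k x]_y g y.
move: f; apply: (mean_unique (L := L)) => [|f bf f0|f c bf].
- rewrite mE// (eq_integral (cst 1%E)); last by move=> x _; rewrite k1.
  by rewrite integral_cst// mul1e.
- rewrite (ge0_integral_mixture mk mE); last 2 first.
  + by move=> y; rewrite lee_fin.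
  + by apply/measurable_EFinP; exact: bf.1.
  rewrite EFin_mean//; last exact: bk.
  by apply: eq_integral => x _; rewrite EFin_mean.
- rewrite /L -[X in _ = _ + X](mean_cst mu1) -meanD//; last 2 first.
  + exact: bk.
  + exact: bmeas_cst.
  apply: eq_Rintegral => x _; rewrite meanD//; last exact: bmeas_cst.
  by rewrite mean_cst.
Qed.

End mean_mixture.

(** * Means under reweighting, path extension and empirical measures *)

Section mean_boltzmann_gibbs.
Context d (T : measurableType d) (R : realType).
Variables (Psi : potential T R) (nu : {measure set T -> \bar R}) (c : R).
Hypotheses (nu1 : nu [set: T] = 1%E) (bPsi : bmeas Psi).
Hypotheses (c_gt0 : 0 < c) (c_le : forall x, c <= Psi x).

Let Z := \int[nu]_x Psi x.

Let Z_gt0 : 0 < Z.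
Proof.
by rewrite (lt_le_trans c_gt0)// -[leLHS](mean_cst nu1) le_mean//; exact: bmeas_cst.
Qed.

Let w_ge0 x : 0 <= Psi x / Z.
Proof. by rewrite divr_ge0// ltW// potential_gt0. Qed.

(** The reweighted measure is the mixture over [nu] of point masses with weight [Psi x / Z], so its
    integrals follow from [ge0_integral_mixture]. *)
Let k x : {measure set T -> \bar R} := mscale (NngNum (w_ge0 x)) (dirac x).

Let ge0_integral_k x (f : T -> \bar R) : measurable_fun [set: T] f ->
  (forall x, 0 <= f x)%E -> (\int[k x]_y f y = (Psi x / Z)%:E * f x)%E.
Proof.
move=> mf f0; rewrite ge0_integral_mscale// integral_dirac//.
by rewrite diracT mul1e.
Qed.

Let mw : measurable_fun [set: T] (fun x => Psi x / Z).
Proof. by apply: measurable_funM => //; exact: bPsi.1. Qed.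

Let mk A : measurable A -> measurable_fun [set: T] (k ^~ A).
Proof.
move=> mA; rewrite /k /= /mscale /=; apply: emeasurable_funM.
  exact/measurable_EFinP.
exact: measurable_fun_dirac.
Qed.

Let mE A : measurable A -> (boltzmann_gibbs Psi nu A = \int[nu]_x k x A)%E.
Proof.
move=> mA; have ZE : mweight Psi nu [set: T] = Z%:E.
  by rewrite /mweight -EFin_mean.
rewrite /boltzmann_gibbs /= /mnormalize /= ZE eqe gt_eqF//= /mweight.
have mPsi : measurable_fun A (fun x => (Psi x)%:E).
  by apply: measurable_funTS; exact/measurable_EFinP/bPsi.1.
rewrite integral_mkcond -ge0_integralZr//.
- apply: eq_integral => x _; rewrite /k /= /mscale /= patchE diracE.
  by case: ifPn => xA; rewrite ?mul0e ?mule0 // mule1 EFinM.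
- by rewrite -(measurable_restrictT _ mA).
- by move=> x _; rewrite patchE; case: ifPn => // _; rewrite lee_fin ltW// potential_gt0.
- by rewrite lee_fin invr_ge0 ltW.
Qed.

Lemma mean_boltzmann_gibbs (f : T -> R) : bmeas f ->
  \int[boltzmann_gibbs Psi nu]_x f x =
  (\int[nu]_x (Psi x * f x)) / \int[nu]_x Psi x.
Proof.
move=> bf.
pose L (f : T -> R) := (\int[nu]_x (Psi x * f x)) / Z.
apply: (mean_unique (L := L)) => //; first exact: probability_setT.
  move=> {bf} {}f bf f0; rewrite (ge0_integral_mixture mk mE); last 2 first.
  - by move=> x; rewrite lee_fin.
  - by apply/measurable_EFinP; exact: bf.1.
  rewrite /L mulrC -meanZ//; last exact: bmeasM.
  rewrite EFin_mean//; last by apply: bmeasZ; exact: bmeasM.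
  apply: eq_integral => x _; rewrite ge0_integral_k//.
  - by rewrite -EFinM; congr EFin; rewrite mulrA [_^-1 * _]mulrC.
  - by apply/measurable_EFinP; exact: bf.1.
move=> {bf} {}f r bf; rewrite /L; under eq_Rintegral do rewrite mulrDr (mulrC _ r).
rewrite meanD//; [|exact: bmeasM|exact: bmeasZ].
by rewrite meanZ// mulrDl mulfK// gt_eqF.
Qed.

End mean_boltzmann_gibbs.

Section mean_path_kernel.
Context d (E : measurableType d) (R : realType) (q : R.-pker E ~> E) (n : nat).

Lemma measurable_rcons_at (t : n.+1.-tuple E) :
  measurable_fun [set: E] (fun x => tuple_rcons (t, x)).
Proof.
exact: (measurableT_comp (@measurable_tuple_rcons _ _ n.+1) (pair1_measurable t)).
Qed.

Lemma mean_path_kernel (t : n.+1.-tuple E) (f : n.+2.-tuple E -> R) : bmeas f ->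
  \int[path_kernel q n t]_u f u =
  \int[q (tuple_last t)]_x f (tuple_rcons (t, x)).
Proof.
move=> bf; pose k x : {measure set (n.+2.-tuple E) -> \bar R} :=
  dirac (tuple_rcons (t, x)).
have mrc := measurable_rcons_at t.
have mk A : measurable A -> measurable_fun [set: E] (k ^~ A).
  move=> mA; exact: (measurableT_comp (measurable_fun_dirac mA) mrc).
rewrite (mean_mixture (mu := q (tuple_last t)) (k := k))//.
- apply: eq_Rintegral => x _; rewrite /Rintegral /k integral_dirac//.
    by rewrite diracT mul1e.
  by apply/measurable_EFinP; exact: bf.1.
- exact: prob_kernel.
- by move=> x; rewrite /k /= diracT.
- move=> A mA; rewrite /k /= /path_kernel_at /pushforward.
  have mB : measurable ((fun x => tuple_rcons (t, x)) @^-1` A).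
    by rewrite -[X in measurable X]setTI; exact: mrc.
  set B := (X in q _ X); rewrite -[B]setIT -integral_indic//.
Qed.

Lemma mean_kact_path_kernel (mu : {measure set (n.+1.-tuple E) -> \bar R})
    (f : n.+2.-tuple E -> R) : mu [set: _] = 1%E -> bmeas f ->
  \int[kact mu (path_kernel q n)]_u f u =
  \int[mu]_t \int[q (tuple_last t)]_x f (tuple_rcons (t, x)).
Proof.
move=> mu1 bf; rewrite (mean_mixture (mu := mu) (k := path_kernel q n))//.
- by apply: eq_Rintegral => t _; rewrite mean_path_kernel.
- by move=> t; exact: prob_kernel.
- by move=> A mA; exact: measurable_kernel.
Qed.

End mean_path_kernel.

Section mean_empirical.
Context d (T : measurableType d) (R : realType) (N : nat).
Hypothesis N_gt0 : (0 < N)%N.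

Lemma ge0_integral_empirical (z : N.-tuple T) (f : T -> R) :
  measurable_fun [set: T] f -> (forall x, 0 <= f x) ->
  (\int[empirical R z]_x (f x)%:E = (N%:R^-1 * \sum_(i < N) f (tnth z i))%:E)%E.
Proof.
move=> mf f0; have mf' : measurable_fun [set: T] (fun x => (f x)%:E).
  exact/measurable_EFinP.
rewrite ge0_integral_mscale//=; last by move=> x _; rewrite lee_fin.
rewrite ge0_integral_measure_sum//; last by move=> x _; rewrite lee_fin.
rewrite EFinM; congr (_ * _)%E; rewrite -sumEFin; apply: eq_bigr => i _.
by rewrite integral_dirac// diracT mul1e (tnth_nth point).
Qed.

Lemma empirical_setT (z : N.-tuple T) : empirical R z [set: T] = 1%E.
Proof.
have <- : (\int[empirical R z]_x (cst 1 x)%:E = empirical R z [set: T])%E.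
  by rewrite -[RHS]mul1e -integral_cst.
rewrite ge0_integral_empirical//.
by rewrite sumr_const card_ord mulVf// pnatr_eq0 -lt0n.
Qed.

Lemma mean_empirical (z : N.-tuple T) (f : T -> R) : bmeas f ->
  \int[empirical R z]_x f x = N%:R^-1 * \sum_(i < N) f (tnth z i).
Proof.
pose L (f : T -> R) := N%:R^-1 * \sum_(i < N) f (tnth z i).
apply: (mean_unique (L := L)) => [|g bg g0|g c _]; first exact: empirical_setT.
  by rewrite ge0_integral_empirical//; exact: bg.1.
rewrite /L big_split /= sumr_const card_ord mulrDr -[c *+ N]mulr_natl mulKf//.
by rewrite pnatr_eq0 -lt0n.
Qed.

End mean_empirical.

(** * Monte Carlo error of an independent sample *)

Section sampling.
Context d (T : measurableType d) (R : realType) (nu : probability T R).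
Let nu1 : nu [set: T] = 1%E := probability_setT nu.
Let iid1 N : iid nu N [set: _] = 1%E := probability_setT (iid nu N).

Lemma measurable_cons_at N (x : T) :
  measurable_fun [set: N.-tuple T] (fun z => tuple_cons (x, z)).
Proof.
exact: (measurableT_comp (@measurable_tuple_cons _ _ N) (pair1_measurable x)).
Qed.

Lemma bmeas_mean_pair d' (X : measurableType d') N
    (g : X * N.-tuple T -> R) :
  bmeas g -> bmeas (fun x => \int[iid nu N]_z g (x, z)).
Proof.
move=> bg; have [mg [M gM]] := bg.
have bgx x : bmeas (fun z : N.-tuple T => g (x, z)).
  exact: (bmeas_comp (pair1_measurable x) bg).
split; last first.
  by exists M => x; exact: (mean_bound (iid1 N) (bgx x) (fun z => gM (x, z))).
have -> : (fun x => \int[iid nu N]_z g (x, z)) =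
    (fun x => \int[iid nu N]_z (g (x, z) + M) - M).
  apply/funext => x; rewrite (meanD (iid1 N))//; last exact: bmeas_cst.
  by rewrite (mean_cst (iid1 N)) addrK.
apply: measurable_funB => //; apply/measurable_EFinP.
have bgM : bmeas (fun xz => g xz + M) by apply: bmeasD => //; exact: bmeas_cst.
rewrite (_ : _ \o _ = fubini_F (iid nu N) (fun xz => (g xz + M)%:E)); last first.
  apply/funext => x /=; rewrite /fubini_F (EFin_mean (iid1 N))//.
  by apply: bmeasD => //; exact: bmeas_cst.
apply: measurable_fun_fubini_tonelli_F.
  by apply/measurable_EFinP; exact: bgM.1.
by move=> x; rewrite lee_fin -lerBlDr sub0r; have := gM x; rewrite ler_norml => /andP[].
Qed.

Lemma mean_iidS N (f : N.+1.-tuple T -> R) : bmeas f ->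
  \int[iid nu N.+1]_z f z =
  \int[nu]_x \int[iid nu N]_z f (tuple_cons (x, z)).
Proof.
pose L (f : N.+1.-tuple T -> R) :=
  \int[nu]_x \int[iid nu N]_z f (tuple_cons (x, z)).
have bcons f0 : bmeas f0 -> bmeas (fun xz : T * N.-tuple T => f0 (tuple_cons xz) : R).
  by apply: bmeas_comp; exact: measurable_tuple_cons.
have bconsx f0 x : bmeas f0 -> bmeas (fun z : N.-tuple T => f0 (tuple_cons (x, z)) : R).
  by apply: bmeas_comp; exact: measurable_cons_at.
move: f; apply: (mean_unique (L := L)) => [|f bf f0|f c bf].
- exact: probability_setT.
- have mf : measurable_fun [set: N.+1.-tuple T] (fun z => (f z)%:E).
    by apply/measurable_EFinP; exact: bf.1.
  rewrite /= ge0_integral_distribution//.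
  have mfc : measurable_fun [set: T * N.-tuple T]
      ((fun z => (f z)%:E) \o @tuple_cons _ T N).
    exact: (measurableT_comp mf (@measurable_tuple_cons _ _ N)).
  rewrite fubini_tonelli1//; last by move=> z; rewrite lee_fin.
  rewrite /L (EFin_mean nu1); last exact: (bmeas_mean_pair (bcons _ bf)).
  by apply: eq_integral => x _; rewrite (EFin_mean (iid1 N))//; exact: bconsx.
- rewrite /L -[X in _ = _ + X](mean_cst nu1) -(meanD nu1); last 2 first.
  + exact: (bmeas_mean_pair (bcons _ bf)).
  + exact: bmeas_cst.
  apply: eq_Rintegral => x _; rewrite (meanD (iid1 N)).
  + by rewrite (mean_cst (iid1 N)).
  + exact: bconsx.
  + exact: bmeas_cst.
Qed.

Let S (g : T -> R) N (z : N.-tuple T) := \sum_(i < N) g (tnth z i).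

Let bmeasS g N : bmeas g -> bmeas (@S g N).
Proof.
move=> [mg [M gM]]; split.
  apply: measurable_sum => i.
  exact: (measurableT_comp mg (measurable_tnth i)).
exists (\sum_(i < N) M) => z.
by rewrite (le_trans (ler_norm_sum _ _ _))// ler_sum.
Qed.

Let S_cons g N x (z : N.-tuple T) : S g (tuple_cons (x, z)) = g x + S g z.
Proof.
rewrite /S big_ord_recl; congr (_ + _).
by apply: eq_bigr => i _; rewrite !(tnth_nth x).
Qed.

(** Induction on [N], peeling off one sample: the cross term [2 * m * g x] has mean zero because [g]
    is centred. *)
Lemma mean_sum_iid_sqr (g : T -> R) N : bmeas g -> \int[nu]_x g x = 0 ->
  \int[iid nu N]_z (\sum_(i < N) g (tnth z i)) ^+ 2 =
  N%:R * \int[nu]_x (g x) ^+ 2.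
Proof.
move=> bg g0; have bS n : bmeas (@S g n) by exact: bmeasS.
have bS2 n : bmeas (fun z : n.-tuple T => S g z ^+ 2).
  by under eq_fun do rewrite expr2; exact: bmeasM.
have bg2 : bmeas (fun x => g x ^+ 2).
  by under eq_fun do rewrite expr2; exact: bmeasM.
elim: N => [|N IH].
  rewrite mul0r -[RHS](mean_cst (iid1 0)); apply: eq_Rintegral => z _.
  by rewrite big_ord0 expr0n.
rewrite (mean_iidS (bS2 _)).
change (\int[iid nu N]_z S g z ^+ 2 = N%:R * \int[nu]_x g x ^+ 2) in IH.
set m := \int[iid nu N]_z S g z.
transitivity (\int[nu]_x (g x ^+ 2 + ((2 * m) * g x + N%:R * \int[nu]_x g x ^+ 2))).
  apply: eq_Rintegral => x _.
  transitivity (\int[iid nu N]_z (g x ^+ 2 + ((2 * g x) * S g z + S g z ^+ 2))).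
    by apply: eq_Rintegral => z _; rewrite S_cons; ring.
  have bZ : bmeas (fun z : N.-tuple T => 2 * g x * S g z) by exact: bmeasZ.
  rewrite (meanD (iid1 N))//; [|exact: bmeas_cst|exact: (bmeasD bZ (bS2 N))].
  rewrite (mean_cst (iid1 N)) (meanD (iid1 N)) ?(meanZ (iid1 N)) //;
    [|exact: bS|exact: bS2].
  rewrite IH -/m; congr (_ + (_ + _)).
  by ring.
have bZ : bmeas (fun x => 2 * m * g x) by exact: bmeasZ.
rewrite (meanD nu1)//; last by apply: bmeasD => //; exact: bmeas_cst.
rewrite (meanD nu1)//; last exact: bmeas_cst.
by rewrite (meanZ nu1)// g0 (mean_cst nu1) -natr1; ring.
Qed.

(** The empirical mean has variance at most [M ^+ 2 / N]; a pointwise AM-GM inequality replaces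
    Cauchy-Schwarz in passing to the first absolute moment. *)
Lemma monte_carlo (h : T -> R) N M : (0 < N)%N -> bmeas h -> 0 <= M ->
  (forall x, `|h x| <= M) ->
  \int[iid nu N]_z `|\int[empirical R z]_x h x - \int[nu]_x h x|
  <= M / Num.sqrt N%:R.
Proof.
(* The case [M = 0] is separate because the scale [s] below is inverted. *)
move=> N0 bh; rewrite le_eqVlt => /predU1P[<- hM|M0 hM].
  rewrite mul0r -[leRHS](mean_cst (iid1 N)) le_eqVlt; apply/orP; left.
  apply/eqP; apply: eq_Rintegral => z _.
  have -> : h = fun=> 0.
    apply/funext => x; apply: normr0_eq0; apply/eqP.
    by rewrite eq_le hM normr_ge0.
  by rewrite (mean_cst (empirical_setT R N0 z)) (mean_cst nu1) subrr normr0.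
set mh := \int[nu]_x h x; pose g x := h x - mh.
have bg : bmeas g by apply: bmeasB => //; exact: bmeas_cst.
have bh2 : bmeas (fun x => h x ^+ 2).
  by under eq_fun do rewrite expr2; exact: bmeasM.
have g0 : \int[nu]_x g x = 0.
  by rewrite (meanB nu1)//; [rewrite (mean_cst nu1) subrr|exact: bmeas_cst].
have g2 : \int[nu]_x g x ^+ 2 <= M ^+ 2.
  have -> : \int[nu]_x g x ^+ 2 = \int[nu]_x h x ^+ 2 - mh ^+ 2.
    transitivity (\int[nu]_x (h x ^+ 2 + ((- 2 * mh) * h x + mh ^+ 2))).
      by apply: eq_Rintegral => x _; rewrite /g; ring.
    have bZ : bmeas (fun x => - 2 * mh * h x) by exact: bmeasZ.
    rewrite (meanD nu1)//; last by apply: bmeasD => //; exact: bmeas_cst.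
    rewrite (meanD nu1)//; last exact: bmeas_cst.
    by rewrite (meanZ nu1)// (mean_cst nu1) -/mh; ring.
  rewrite lerBlDr -[leLHS]addr0 lerD ?sqr_ge0//.
  rewrite -[leRHS](mean_cst nu1) (le_mean nu1)//; first exact: bmeas_cst.
  by move=> x; rewrite -(real_normK (num_real (h x))) lerXn2r ?nnegrE// ltW.
(* With this scale each of the two terms of the AM-GM bound contributes at most [s / 2]. *)
set s := M / Num.sqrt N%:R.
have sN0 : 0 < Num.sqrt (N%:R : R) by rewrite sqrtr_gt0 ltr0n.
have s0 : 0 < s by rewrite divr_gt0.
have bY : bmeas (fun z : N.-tuple T => N%:R^-1 * S g z).
  by apply: bmeasZ; exact: bmeasS.
have bY2 : bmeas (fun z : N.-tuple T => (N%:R^-1 * S g z) ^+ 2).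
  by under eq_fun do rewrite expr2; exact: bmeasM.
have NE : N%:R != 0 :> R by rewrite pnatr_eq0 -lt0n.
have -> : \int[iid nu N]_z `|\int[empirical R z]_x h x - mh| =
          \int[iid nu N]_z `|N%:R^-1 * S g z|.
  apply: eq_Rintegral => z _; congr `|_|; rewrite mean_empirical// /S.
  rewrite sumrB sumr_const card_ord mulrBr -[mh *+ N]mulr_natl mulKf//.
(* AM-GM: [2 s |y| <= s^2 + y^2] *)
apply: (@le_trans _ _ (\int[iid nu N]_z
    (s / 2 + (2 * s)^-1 * (N%:R^-1 * S g z) ^+ 2))).
  apply: (le_mean (iid1 N)); first exact: bmeas_norm.
    by apply: bmeasD; [exact: bmeas_cst|exact: bmeasZ].
  move=> z; set y := N%:R^-1 * _; rewrite -(real_normK (num_real y)).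
  have ys : 0 <= (2 * s)^-1 * (s - `|y|) ^+ 2.
    by rewrite mulr_ge0 ?sqr_ge0// invr_ge0 mulr_ge0// ltW.
  rewrite -subr_ge0; apply: le_trans ys _; rewrite le_eqVlt; apply/orP; left.
  by apply/eqP; field; exact: lt0r_neq0.
rewrite (meanD (iid1 N))//; [|exact: bmeas_cst|exact: bmeasZ].
rewrite (mean_cst (iid1 N)) (meanZ (iid1 N))//.
under eq_Rintegral do rewrite exprMn.
rewrite (meanZ (iid1 N)); last first.
  by under eq_fun do rewrite expr2; apply: bmeasM; exact: bmeasS.
rewrite mean_sum_iid_sqr//.
have ss : s ^+ 2 = M ^+ 2 / N%:R.
  by rewrite /s expr_div_n sqr_sqrtr// ler0n.
have -> : N%:R^-1 ^+ 2 * (N%:R * \int[nu]_x g x ^+ 2) = (\int[nu]_x g x ^+ 2) / N%:R.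
  by field.
have : (\int[nu]_x g x ^+ 2) / N%:R <= s ^+ 2.
  by rewrite ss ler_wpM2r// invr_ge0 ler0n.
move=> le; rewrite -[leRHS](_ : s / 2 + (2 * s)^-1 * s ^+ 2 = _); last first.
  by field; exact: lt0r_neq0.
by rewrite lerD2l ler_wpM2l// invr_ge0 mulr_ge0// ltW.
Qed.

End sampling.

(** * Comparison of measures and the inequalities behind the contraction *)

Lemma le_mean_measure d (T : measurableType d) (R : realType)
    (m1 m2 : {measure set T -> \bar R}) (c : R) (f : T -> R) :
  m1 [set: T] = 1%E -> m2 [set: T] = 1%E -> 0 <= c ->
  (forall A, measurable A -> m1 A <= c%:E * m2 A)%E ->
  bmeas f -> (forall x, 0 <= f x) ->
  \int[m1]_x f x <= c * \int[m2]_x f x.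
Proof.
move=> m11 m21 c0 m12 bf f0.
have mf : measurable_fun [set: T] (fun x => (f x)%:E).
  by apply/measurable_EFinP; exact: bf.1.
rewrite -lee_fin EFinM !EFin_mean//.
have f0' x : [set: T] x -> (0 <= (f x)%:E)%E by rewrite lee_fin.
rewrite -(ge0_integral_mscale m2 measurableT (NngNum c0) mf f0').
exact: ge0_le_measure_integral.
Qed.

(* [x = a (1 - a')] and [y = a' (1 - a)] satisfy [x - y = a - a'] and
   [sqrt x + sqrt y <= 1], the latter squared being
   [2 (x + y) <= 1 + (x - y) ^+ 2]. *)
Lemma odds_ratio_le (R : realFieldType) (k a a' : R) :
  1 <= k -> 0 <= a <= 1 -> 0 <= a' <= 1 ->
  a * (1 - a') <= k ^+ 2 * (a' * (1 - a)) ->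
  a - a' <= (k - 1) / (k + 1).
Proof.
move=> k1 /andP[a0 a1] /andP[a'0 a'1] H.
have kp : 0 < k + 1 by lra.
rewrite ler_pdivlMr// leNgt; apply/negP => h.
(* With [x] and [y] as above, this product equals [(k ^+ 2 - 1) * (1 - a - a') ^+ 2 + 4 * (k ^+ 2 *
   y - x)]. Its second factor is negative, so its first factor cannot be positive. *)
have P : 0 <= ((k + 1) * (a - a') - (k - 1)) * ((k - 1) * (a - a') - (k + 1)).
  have sq : 0 <= (k ^+ 2 - 1) * (1 - a - a') ^+ 2.
    by rewrite mulr_ge0 ?sqr_ge0// subr_ge0 expr_ge1// ltW// (lt_le_trans ltr01).
  nra.
have n : (k - 1) * (a - a') - (k + 1) < 0 by nra.
by move: P; rewrite leNgt nmulr_llt0// subr_gt0 mulrC h.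
Qed.

(** Multiplying the two one-sided comparisons makes [u * u'] cancel and bounds by [k ^+ 2] the odds
    ratio of the relative positions of [v / u] and [v' / u'] in the interval from [al] to [be]. *)
Lemma osc_contraction (R : realFieldType) (k u u' v v' al be : R) :
  1 <= k -> 0 < u -> 0 < u' ->
  al * u <= v <= be * u -> al * u' <= v' <= be * u' ->
  v - al * u <= k * (v' - al * u') ->
  be * u' - v' <= k * (be * u - v) ->
  v / u - v' / u' <= (k - 1) / (k + 1) * (be - al).
Proof.
move=> k1 u0 u'0 /andP[v1 v2] /andP[v'1 v'2] H1 H2.
have kp : 0 < k + 1 by lra.
have [w vE] : exists w, v = w * u by exists (v / u); rewrite divfK ?gt_eqF.
have [w' v'E] : exists w', v' = w' * u' by exists (v' / u'); rewrite divfK ?gt_eqF.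
move: v1 v2 v'1 v'2 H1 H2; rewrite vE v'E !mulfK ?gt_eqF//.
rewrite !ler_pM2r// -!mulrBl => w1 w2 w'1 w'2 H1 H2.
(* An interval of length zero cannot be rescaled to the unit interval; there both ratios equal
   [al]. *)
have [ab|ab] := eqVneq (be - al) 0.
  by rewrite ab mulr0; lra.
have ab0 : 0 < be - al by rewrite lt_def ab subr_ge0 (le_trans w1).
have W : (w - al) * (be - w') <= k ^+ 2 * ((w' - al) * (be - w)).
  have uu : 0 < u * u' by rewrite mulr_gt0.
  rewrite -(ler_pM2r uu).
  have l1 : 0 <= (w - al) * u by rewrite mulr_ge0 ?subr_ge0// ltW.
  have l2 : 0 <= (be - w') * u' by rewrite mulr_ge0 ?subr_ge0// ltW.
  by have := ler_pM l1 l2 H1 H2; congr (_ <= _); ring.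
pose x := (w - al) / (be - al); pose x' := (w' - al) / (be - al).
have x01 : 0 <= x <= 1.
  apply/andP; split; last by rewrite ler_pdivrMr// mul1r lerD2r.
  by apply: divr_ge0; [rewrite subr_ge0|exact: ltW].
have x'01 : 0 <= x' <= 1.
  apply/andP; split; last by rewrite ler_pdivrMr// mul1r lerD2r.
  by apply: divr_ge0; [rewrite subr_ge0|exact: ltW].
have xw : x * (be - al) = w - al by rewrite divfK.
have xw' : x' * (be - al) = w' - al by rewrite divfK.
have -> : w - w' = (x - x') * (be - al) by rewrite mulrBl xw xw'; ring.
apply: ler_wpM2r; first exact: ltW.
apply: odds_ratio_le => //.
rewrite -(ler_pM2r (mulr_gt0 ab0 ab0)).
have -> : x * (1 - x') * ((be - al) * (be - al)) = (w - al) * (be - w').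
  by rewrite mulrACA xw [(1 - x') * _]mulrBl mul1r xw'; ring.
have -> : k ^+ 2 * (x' * (1 - x)) * ((be - al) * (be - al)) =
    k ^+ 2 * ((w' - al) * (be - w)).
  rewrite -xw' (_ : be - w = (1 - x) * (be - al)); first by ring.
  by rewrite mulrBl mul1r xw; ring.
exact: W.
Qed.

(** Subtracting [al] from both ratios leaves their difference unchanged and makes the second one at
    most [r] in absolute value, so the error [d2] of the denominator is only charged with the factor
    [r]. Only the denominator [Y] remains in the bound. *)
Lemma ratio_diff_le (R : realFieldType) (X Y X' Y' al d1 d2 r : R) :
  0 < Y -> 0 < Y' -> 0 <= r ->
  `|(X - al * Y) - (X' - al * Y')| <= d1 -> `|Y - Y'| <= d2 ->
  `|X' - al * Y'| <= r * Y' ->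
  `|X / Y - X' / Y'| <= (d1 + r * d2) / Y.
Proof.
move=> Y0 Y'0 r0 h1 h2 h3.
have -> : X / Y - X' / Y' =
    (((X - al * Y) - (X' - al * Y')) + (X' - al * Y') / Y' * (Y' - Y)) / Y.
  by field; rewrite !gt_eqF.
rewrite normrM normfV (gtr0_norm Y0); apply: ler_wpM2r.
  by rewrite invr_ge0 ltW.
rewrite (le_trans (ler_normD _ _))// lerD// normrM ler_pM//.
  by rewrite normrM normfV (gtr0_norm Y'0) ler_pdivrMr.
by rewrite distrC.
Qed.

(** * Backward functions of the truncated model *)

Section backward.
Context d (E : measurableType d) (R : realType).
Variables (Q : nat -> R.-pker E ~> E) (Psit : forall k, k.+1.-tuple E -> R).
Variables (a b : nat -> R).
Hypothesis bPsit : forall k, (0 < k)%N -> bmeas (@Psit k).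
Hypothesis a_ge1 : forall k, (0 < k)%N -> 1 <= a k.
Hypothesis b_ge1 : forall k, (0 < k)%N -> 1 <= b k.
Hypothesis Psit_ge : forall k, (0 < k)%N -> forall t : k.+1.-tuple E,
  (a k)^-1 <= Psit t.
Hypothesis Psit_le : forall k, (0 < k)%N -> forall t : k.+1.-tuple E,
  Psit t <= b k.

(** A family over all times, because the recursion [back] raises the time by one at each step; this
    avoids casts along equations such as [k + m = n]. *)
Definition pathfun := forall k, k.+1.-tuple E -> R.
Implicit Types g h : pathfun.

(* [back g m k t] is the integral of [Psi_(k+1) ... Psi_(k+m) g_(k+m)] over the
   [m] steps of the chain that follow the path [t] up to time [k]. *)
Fixpoint back g m : pathfun := fun k t =>
  match m with
  | 0 => g k t
  | m'.+1 => \int[Q k.+1 (tuple_last t)]_x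
      (Psit (tuple_rcons (t, x)) * back g m' (tuple_rcons (t, x)))
  end.

Lemma Psit_pos k (t : k.+2.-tuple E) : 0 < Psit t.
Proof.
apply: lt_le_trans (Psit_ge _ t) => //.
by rewrite invr_gt0 (lt_le_trans ltr01)// a_ge1.
Qed.

Let Q1 k x : Q k x [set: E] = 1%E. Proof. exact: prob_kernel. Qed.

Lemma bmeas_rcons k (t : k.+1.-tuple E) (f : k.+2.-tuple E -> R) :
  bmeas f -> bmeas (fun x => f (tuple_rcons (t, x))).
Proof. exact: (bmeas_comp (measurable_rcons_at t)). Qed.

Lemma bmeas_step k (f : k.+2.-tuple E -> R) : bmeas f ->
  bmeas (fun t : k.+1.-tuple E =>
    \int[Q k.+1 (tuple_last t)]_x f (tuple_rcons (t, x))).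
Proof.
move=> bf; under eq_fun do rewrite -mean_path_kernel//.
apply: bmeas_mean => //; first by move=> A mA; exact: measurable_kernel.
by move=> t; exact: prob_kernel.
Qed.

Lemma bmeas_Psit_rcons k (t : k.+1.-tuple E) (f : k.+2.-tuple E -> R) :
  bmeas f -> bmeas (fun x => Psit (tuple_rcons (t, x)) * f (tuple_rcons (t, x))).
Proof.
move=> bf.
apply: (@bmeas_rcons k t (fun u => Psit u * f u)).
by apply: bmeasM => //; exact: bPsit.
Qed.

Lemma bmeas_back g m : (forall k, bmeas (@g k)) -> forall k, bmeas (@back g m k).
Proof.
move=> bg; elim: m => [|m IH] k //=.
apply: (bmeas_step (f := fun u => Psit u * back g m u)).
by apply: bmeasM => //; exact: bPsit.
Qed.

Lemma back_lin g h x y m : (forall k, bmeas (@g k)) -> (forall k, bmeas (@h k)) ->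
  forall k (t : k.+1.-tuple E),
  back (fun k t => x * g k t + y * h k t) m t = x * back g m t + y * back h m t.
Proof.
move=> bg bh; elim: m => [|m IH] k t //=.
have bg' := bmeas_Psit_rcons t (bmeas_back m bg k.+1).
have bh' := bmeas_Psit_rcons t (bmeas_back m bh k.+1).
rewrite -(meanZ (Q1 _ _) x bg') -(meanZ (Q1 _ _) y bh') -(meanD (Q1 _ _)).
- by apply: eq_Rintegral => z _; rewrite IH; ring.
- exact: bmeasZ.
- exact: bmeasZ.
Qed.

(** Only the values of [g] at the final time matter; naming that time [e] through an equation avoids
    a cast between tuple types. *)
Lemma back_ge0 g m : forall k,
  (forall e, e = (k + m)%N -> forall t : e.+1.-tuple E, 0 <= g e t) ->
  forall t : k.+1.-tuple E, 0 <= back g m t.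
Proof.
elim: m => [|m IH] k g0 t /=; first by apply: g0; rewrite addn0.
apply: Rintegral_ge0 => x _; rewrite mulr_ge0//; first by rewrite ltW// Psit_pos.
by apply: IH => e ->; apply: g0; rewrite addSnnS.
Qed.

Lemma backD g s m : forall k (t : k.+1.-tuple E),
  back g (s + m) t = back (fun k => @back g m k) s t.
Proof.
elim: s => [|s IH] k t //=.
by apply: eq_Rintegral => x _; rewrite IH.
Qed.

(** Each potential is at least [(a k)^-1]. The bound is uniform in the path, so the means of these
    functions, which occur as denominators, are positive too. *)
Lemma back1_gt0 m : forall k, exists2 c, 0 < c &
  forall t : k.+1.-tuple E, c <= back (fun _ _ => 1) m t.
Proof.
elim: m => [|m IH] k /=; first by exists 1.
have [c c0 cle] := IH k.+1.
have A0 : 0 < (a k.+1)^-1 by rewrite invr_gt0 (lt_le_trans ltr01)// a_ge1.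
exists ((a k.+1)^-1 * c); first by rewrite mulr_gt0.
move=> t; rewrite -[leLHS](mean_cst (Q1 k.+1 (tuple_last t))).
apply: (le_mean (Q1 _ _)); first exact: bmeas_cst.
  apply: (bmeas_Psit_rcons t); apply: bmeas_back => k'; exact: bmeas_cst.
move=> x; apply: ler_pM; [exact: ltW|exact: ltW| |exact: cle].
by apply: Psit_ge.
Qed.

(** The states at times [0] to [i] are ignored. The relation is trivial at [k = i] and is kept when
    both paths are extended by the same state. *)
Definition agree i k (t t' : k.+1.-tuple E) := drop i.+1 t = drop i.+1 t' :> seq E.

Lemma agree_rcons i k (t t' : k.+1.-tuple E) x : (i <= k)%N ->
  agree i t t' -> agree i (tuple_rcons (t, x)) (tuple_rcons (t', x)).
Proof.
by move=> ik; rewrite /agree /= !drop_rcons ?size_tuple// => ->.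
Qed.

Lemma agree_last i k (t t' : k.+1.-tuple E) : (i < k)%N ->
  agree i t t' -> tuple_last t = tuple_last t'.
Proof.
move=> ik tt'; rewrite /tuple_last !(tnth_nth point) /=.
have := congr1 (nth point ^~ (k - i.+1)%N) tt'.
by rewrite !nth_drop subnKC.
Qed.

Lemma agree_diag k (t t' : k.+1.-tuple E) : agree k t t'.
Proof. by rewrite /agree !drop_oversize ?size_tuple. Qed.

(** * Comparison of backward functions from two starting paths *)

Section comparison.
Variables (i e : nat) (D : nat -> R) (g : pathfun).
Hypothesis bg : forall k, bmeas (@g k).
Hypothesis g_ge0 : forall t : e.+1.-tuple E, 0 <= g t.
Hypothesis g_agree : forall t t' : e.+1.-tuple E, agree i t t' -> g t <= g t'.
Hypothesis D_ge0 : forall l, 0 <= D l.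
Hypothesis D_agree : forall l, (i < l <= e)%N -> forall t t' : l.+1.-tuple E,
  agree i t t' -> Psit t <= D l * Psit t'.

Let back_g_ge0 s k (t : k.+1.-tuple E) : (k + s)%N = e -> 0 <= back g s t.
Proof.
by move=> kse; apply: back_ge0 => e' e'E; subst e'; subst e.
Qed.

Let prod_ge0 m n : 0 <= \prod_(m <= l < n) D l.
Proof. exact: prodr_ge0. Qed.

(** As [i < k], both paths end in the same state and the next state has the same law; only the
    potentials differ, at the cost of a factor [D l] for each remaining time. *)
Lemma back_agree s : forall k (t t' : k.+1.-tuple E),
  (i < k)%N -> (k + s)%N = e -> agree i t t' ->
  back g s t <= \prod_(k.+1 <= l < e.+1) D l * back g s t'.
Proof.
elim: s => [|s IH] k t t' ik kse tt'.
  have ke : k = e by rewrite -kse addn0.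
  by subst k; rewrite big_geq// mul1r; exact: g_agree.
rewrite /= (agree_last ik tt') -(meanZ (Q1 _ _)); last first.
  exact: (bmeas_Psit_rcons t' (bmeas_back s bg k.+1)).
have ks : (k.+1 + s)%N = e by rewrite addSnnS.
apply: (le_mean (Q1 _ _)).
- exact: (bmeas_Psit_rcons t (bmeas_back s bg k.+1)).
- by apply: bmeasZ; exact: (bmeas_Psit_rcons t' (bmeas_back s bg k.+1)).
move=> x; have ttx := agree_rcons x (ltnW ik) tt'.
have ke : (k.+1 < e.+1)%N by rewrite ltnS -ks leq_addr.
rewrite big_ltn// mulrACA ler_pM//.
- by rewrite ltW// Psit_pos.
- exact: back_g_ge0.
- by apply: D_agree ttx; rewrite ltnS (ltnW ik).
- by apply: IH ttx; rewrite // ltnW.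
Qed.

(** At time [i] the last states may differ. Exchanging the transition kernel costs [c] once, after
    which both paths are continued by the same states. *)
Lemma back_agree_first c s (t t' : i.+1.-tuple E) : 0 <= c ->
  (forall x x' A, measurable A -> Q i.+1 x A <= c%:E * Q i.+1 x' A)%E ->
  (i + s.+1)%N = e ->
  back g s.+1 t <= c * \prod_(i.+1 <= l < e.+1) D l * back g s.+1 t'.
Proof.
move=> c0 Qc ise; have ks : (i.+1 + s)%N = e by rewrite addSnnS.
have ie : (i.+1 < e.+1)%N by rewrite ltnS -ks leq_addr.
have bt t0 := bmeas_Psit_rcons t0 (bmeas_back s bg i.+1).
rewrite /= -mulrA -(meanZ (Q1 _ _) _ (bt t')).
(* The integrand is changed first, under the kernel from [t]; the kernel is changed afterwards. *)
apply: (@le_trans _ _ (\int[Q i.+1 (tuple_last t)]_x (\prod_(i.+1 <= l < e.+1) D l *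
    (Psit (tuple_rcons (t', x)) * back g s (tuple_rcons (t', x)))))).
  apply: (le_mean (Q1 _ _)); [exact: bt|apply: bmeasZ; exact: bt|move=> x].
  have ttx := agree_rcons x (leqnn i) (agree_diag t t').
  rewrite big_ltn// mulrACA ler_pM//.
  - by rewrite ltW// Psit_pos.
  - exact: back_g_ge0.
  - by apply: D_agree ttx; rewrite leqnn.
  - exact: back_agree.
apply: (le_mean_measure (Q1 _ _) (Q1 _ _) c0 (Qc _ _)); first by apply: bmeasZ; exact: bt.
move=> x; rewrite mulr_ge0// mulr_ge0//; first by rewrite ltW// Psit_pos.
exact: back_g_ge0.
Qed.

End comparison.

Variables (p : nat) (c : nat -> R).
Hypothesis p_gt0 : (0 < p)%N.
Hypothesis c_ge1 : forall k, (0 < k)%N -> 1 <= c k.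
Hypothesis Qc : forall k, (0 < k)%N -> forall x x' A, measurable A ->
  (Q k x A <= (c k)%:E * Q k x' A)%E.

(** Dependence on the last [p] states, phrased through [agree] so that no tuple of size [p] has to
    be extracted. Nothing is required at times [k < p]. *)
Definition tailfun g := forall i k, (i + p <= k)%N ->
  forall t t' : k.+1.-tuple E, agree i t t' -> g k t = g k t'.

Hypothesis tailPsit : forall i k, (i + p <= k)%N ->
  forall t t' : k.+1.-tuple E, agree i t t' -> Psit t = Psit t'.

Lemma tailfun_back g m : tailfun g -> tailfun (@back g m).
Proof.
move=> tg; elim: m => [|m IH] //= i k ik t t' tt'.
have ik' : (i < k)%N by rewrite (leq_trans _ ik)// -addn1 leq_add2l.
rewrite (agree_last ik' tt'); apply: eq_Rintegral => x _.
have ttx := agree_rcons x (ltnW ik') tt'.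
by rewrite (tailPsit (leqW ik) ttx) (IH _ _ (leqW ik) _ _ ttx).
Qed.

(** One factor for the change of kernel, and one for each of the [p - 1] potentials after time [i]
    that still see a state up to time [i]. See [kappaE] for the link with [eps_tilde2]. *)
Definition kappa i := c i.+1 * \prod_(i.+1 <= l < i + p) (a l * b l).

Lemma kappa_ge1 i : 1 <= kappa i.
Proof.
rewrite /kappa -[leLHS]mulr1 ler_pM// ?c_ge1// big_nat_cond.
elim/big_ind : _ => // [x y|l /andP[/andP[il _] _]].
  by move=> x1 y1; rewrite -[leLHS]mulr1 ler_pM.
have l0 : (0 < l)%N by rewrite (leq_trans _ il).
by rewrite -[leLHS]mulr1 ler_pM ?a_ge1 ?b_ge1.
Qed.

(** Two potential values between [(a l)^-1] and [b l] differ at most by the factor [a l * b l], and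
    no factor is lost once the differing states have left the window of length [p]. *)
Lemma back_kappa g i s : (forall k, bmeas (@g k)) -> (s < p)%N ->
  (forall e, e = (i + s.+1)%N -> (forall t : e.+1.-tuple E, 0 <= g e t) /\
    forall t t' : e.+1.-tuple E, agree i t t' -> g e t <= g e t') ->
  forall t t' : i.+1.-tuple E, back g s.+1 t <= kappa i * back g s.+1 t'.
Proof.
move=> bg sp /(_ _ erefl)[g0 gi] t t'.
(* From time [i + p] on the potentials do not see the states up to time [i]; at [l = 0] no bound on
   [a] and [b] is assumed. *)
pose D l := if (0 < l < i + p)%N then a l * b l else 1.
have D1 l : 1 <= D l.
  rewrite /D; case: ifPn => // /andP[l0 _].
  by rewrite -[leLHS]mulr1 ler_pM ?a_ge1 ?b_ge1.
have D0 l : 0 <= D l by rewrite (le_trans ler01).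
have Da l : (i < l <= i + s.+1)%N -> forall t t' : l.+1.-tuple E,
    agree i t t' -> Psit t <= D l * Psit t'.
  move=> /andP[il lis] u u' uu'; have l0 : (0 < l)%N by rewrite (leq_trans _ il).
  rewrite /D l0/=; case: ltnP => [lip|pil].
    rewrite -mulrA (le_trans (Psit_le l0 u))// mulrCA ler_peMr//.
      by rewrite (le_trans ler01)// b_ge1.
    by rewrite -ler_pdivrMl ?(lt_le_trans ltr01) ?a_ge1// mulr1 Psit_ge.
  by rewrite mul1r (tailPsit pil uu').
have c0 : 0 <= c i.+1 by rewrite (le_trans ler01)// c_ge1.
apply: le_trans (back_agree_first bg g0 gi D0 Da t t' c0 (Qc _) erefl) _ => //.
apply: ler_wpM2r; first by apply: back_ge0 => e eE; subst e.
rewrite /kappa ler_wpM2l//.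
(* Extending the range up to time [i + p] only adds factors that are at least one, so one constant
   serves all [s < p]. *)
rewrite (_ : \prod_(i.+1 <= l < i + p) (a l * b l) =
    \prod_(i.+1 <= l < (i + p).+1) D l).
  rewrite [leRHS](@big_cat_nat _ _ _ (i + s.+1).+1)//=; last first.
  - by rewrite ltnS leq_add2l.
  - by rewrite ltnS leq_addr.
  rewrite ler_peMr//; first exact: prodr_ge0.
  by elim/big_ind : _ => // x y x1 y1; rewrite -[leLHS]mulr1 ler_pM.
have ip : (i.+1 <= i + p)%N by rewrite -addn1 leq_add2l.
rewrite big_nat_recr//= {2}/D ltnn andbF mulr1.
by apply: eq_big_nat => l /andP[il lp]; rewrite /D lp (leq_trans _ il).
Qed.

Lemma back_kappa_p g i : (forall k, bmeas (@g k)) -> tailfun g ->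
  (forall t : (i + p).+1.-tuple E, 0 <= g _ t) ->
  forall t t' : i.+1.-tuple E, back g p t <= kappa i * back g p t'.
Proof.
move=> bg tg g0 t t'; have := @back_kappa g i p.-1 bg.
rewrite prednK// leqnn => /(_ isT); apply => e ->; split => // u u' uu'.
by rewrite (tg i _ _ u u').
Qed.

Definition path_one : pathfun := fun _ _ => 1.

Lemma bmeas_path_one k : bmeas (@path_one k). Proof. exact: bmeas_cst. Qed.

(** The constant does not grow with [m]: beyond [p] steps, the remaining ones are absorbed into a
    nonnegative tail function at the end of a single block. *)
Lemma back1_kappa m i (t t' : i.+1.-tuple E) :
  back path_one m t <= kappa i * back path_one m t'.
Proof.
case: m => [|m]; first by rewrite /= mulr1 kappa_ge1.
have [mp|pm] := ltnP m p.
  by apply: (back_kappa bmeas_path_one mp) => e _; split => // *; exact: ler01.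
rewrite -(subnKC (leqW pm)) !backD; apply: back_kappa_p.
- by apply: bmeas_back; exact: bmeas_path_one.
- by apply: tailfun_back.
- by move=> u; apply: back_ge0 => e _ *; exact: ler01.
Qed.

Definition rho i := (kappa i - 1) / (kappa i + 1).

Lemma rho_ge0 i : 0 <= rho i.
Proof.
have k1 := kappa_ge1 i.
by rewrite divr_ge0 ?subr_ge0// addr_ge0// (le_trans ler01).
Qed.

Lemma rho_le1 i : rho i <= 1.
Proof. by have k1 := kappa_ge1 i; rewrite ler_pdivrMr; lra. Qed.

(** * Contraction of the oscillation *)

Section oscillation.
Variable f : pathfun.
Hypothesis bf : forall k, bmeas (@f k).
Hypothesis f_le1 : forall k (t : k.+1.-tuple E), `|f t| <= 1.
Hypothesis tail_f : tailfun f.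

Let U m i (t : i.+1.-tuple E) := back path_one m t.

Let U_gt0 m i (t : i.+1.-tuple E) : 0 < U m t.
Proof. by have [c' c'0 /(_ t)] := back1_gt0 m i; exact: lt_le_trans. Qed.

Let lin g x y m k (t : k.+1.-tuple E) : (forall k, bmeas (@g k)) ->
  back (fun k t => x * g k t + y * path_one t) m t =
  x * back g m t + y * back path_one m t.
Proof. by move=> bg; apply: back_lin => // k'; exact: bmeas_path_one. Qed.

(** Strong induction on [m], splitting off the first block of [p] steps: bounds on the ratio at time
    [i + p] are contracted by [rho i]. *)
Lemma back_osc m : forall i, exists al be : R,
  be - al <= 2 * \prod_(0 <= j < m %/ p) rho (i + j * p) /\
  forall t : i.+1.-tuple E,
    al * back path_one m t <= back f m t <= be * back path_one m t.
Proof.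
elim/ltn_ind: m => m IH i; have [mp|pm] := ltnP m p.
  (* Without a complete block, [|f| <= 1] gives the initial oscillation [2]. *)
  exists (-1), 1; split; first by rewrite divn_small// big_geq//; lra.
  move=> t; rewrite -subr_ge0 mulN1r opprK mul1r -[X in _ && X]subr_ge0.
  have := @lin f 1 1 m i t bf; rewrite !mul1r => <-.
  have := @lin f (-1) 1 m i t bf; rewrite !mul1r mulN1r addrC => <-.
  apply/andP; split; apply: back_ge0 => e _ u;
    by have := f_le1 u; rewrite /path_one ler_norml => /andP[]; lra.
have mpm : (m - p < m)%N by rewrite ltn_subrL p_gt0 (leq_trans p_gt0).
have [al [be [ab bd]]] := IH _ mpm (i + p)%N.
have osc (t t' : i.+1.-tuple E) :
    back f m t / back path_one m t - back f m t' / back path_one m t' <=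
    rho i * (be - al).
  have A g k (u : k.+1.-tuple E) : back g m u = back (@back g (m - p)) p u.
    by rewrite -backD subnKC.
  rewrite !A.
  set f' := @back f (m - p); set u' := @back path_one (m - p).
  have bf' k : bmeas (@f' k) by exact: bmeas_back.
  have bu' k : bmeas (@u' k) by apply: bmeas_back; exact: bmeas_path_one.
  have tf' : tailfun f' by exact: tailfun_back.
  have tu' : tailfun u' by exact: tailfun_back.
  (* The gaps to the lower and the upper bound are nonnegative tail functions, so the block
     comparison [back_kappa_p] applies to each; these are the two comparisons that [osc_contraction]
     needs. *)
  pose g1 : pathfun := fun k t => 1 * f' k t + (- al) * u' k t.
  pose g2 : pathfun := fun k t => (-1) * f' k t + be * u' k t.
  have bg1 k : bmeas (@g1 k) by apply: bmeasD; exact: bmeasZ.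
  have bg2 k : bmeas (@g2 k) by apply: bmeasD; exact: bmeasZ.
  have tg1 : tailfun g1.
    by move=> j k jk v v' vv'; rewrite /g1 (tf' _ _ jk _ _ vv') (tu' _ _ jk _ _ vv').
  have tg2 : tailfun g2.
    by move=> j k jk v v' vv'; rewrite /g2 (tf' _ _ jk _ _ vv') (tu' _ _ jk _ _ vv').
  have g10 (v : (i + p).+1.-tuple E) : 0 <= g1 _ v.
    by have /andP[] := bd v; rewrite /g1 /f' /u'; lra.
  have g20 (v : (i + p).+1.-tuple E) : 0 <= g2 _ v.
    by have /andP[] := bd v; rewrite /g2 /f' /u'; lra.
  have E1 (v : i.+1.-tuple E) : back g1 p v = back f' p v - al * back u' p v.
    by rewrite (@back_lin f' u' 1 (- al))//; ring.
  have E2 (v : i.+1.-tuple E) : back g2 p v = be * back u' p v - back f' p v.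
    by rewrite (@back_lin f' u' (-1) be)//; ring.
  have p1 (v : i.+1.-tuple E) : al * back u' p v <= back f' p v <= be * back u' p v.
    apply/andP; split.
      by rewrite -subr_ge0 -E1; apply: back_ge0 => e ->; exact: g10.
    by rewrite -subr_ge0 -E2; apply: back_ge0 => e ->; exact: g20.
  apply: osc_contraction => //.
  - exact: kappa_ge1.
  - by rewrite -A; exact: U_gt0.
  - by rewrite -A; exact: U_gt0.
  - by rewrite -!E1; exact: back_kappa_p.
  - by rewrite -!E2; exact: back_kappa_p.
pose t0 : i.+1.-tuple E := point.
(* [osc] controls differences of ratios only; the supremum of the ratios turns this into bounds
   common to all paths. *)
pose W := range (fun t : i.+1.-tuple E => back f m t / back path_one m t).
have W0 : W !=set0 by exists (back f m t0 / back path_one m t0), t0.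
have Wub : has_ubound W.
  exists (rho i * (be - al) + back f m t0 / back path_one m t0) => _ [t _ <-].
  by rewrite -lerBlDr osc.
exists (sup W - rho i * (be - al)), (sup W); split.
  rewrite opprB addrC subrK.
  have -> : (m %/ p = ((m - p) %/ p).+1)%N.
    by rewrite -{1}(subnK pm) divnDr// divnn p_gt0 addn1.
  rewrite big_nat_recl//= mul0n addn0 mulrCA ler_wpM2l ?rho_ge0//.
  rewrite (le_trans ab)// le_eqVlt; apply/orP; left; apply/eqP; congr (_ * _).
  by apply: eq_bigr => j _; rewrite mulSn addnA.
move=> t; rewrite -ler_pdivlMr ?U_gt0// -[X in _ && X]ler_pdivrMr ?U_gt0//.
apply/andP; split; last by apply: sup_upper_bound => //; exists t.
rewrite lerBlDr; apply: ge_sup => // _ [t' _ <-].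
by rewrite -lerBlDl.
Qed.

(** The midpoint of the interval from [back_osc] is the centre, which halves the initial oscillation
    [2]. *)
Lemma back_center m i : exists al : R, forall t : i.+1.-tuple E,
  `|back f m t - al * back path_one m t| <=
  \prod_(0 <= j < m %/ p) rho (i + j * p) * back path_one m t.
Proof.
have [al [be [ab bd]]] := back_osc m i; exists ((al + be) / 2) => t.
have := bd t; set r := \prod_(_ <= _ < _) _ in ab *.
have u0 := U_gt0 m t; rewrite /U in u0.
move=> /andP[v1 v2]; rewrite ler_norml.
have ru : (be - al) * back path_one m t <= 2 * r * back path_one m t.
  by rewrite ler_wpM2r// ltW.
by apply/andP; split; lra.
Qed.

(** The mean of the test function after [m] further steps of the truncated filter started from
    [mu]. *)
Definition filter_ratio m k (mu : probability (k.+1.-tuple E) R) : R :=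
  (\int[mu]_t back f m t) / \int[mu]_t back path_one m t.

Let bback1 m k : bmeas (@back path_one m k).
Proof. by apply: bmeas_back; exact: bmeas_path_one. Qed.

Let bbackf m k : bmeas (@back f m k).
Proof. exact: bmeas_back. Qed.

Let mean_gt0 d' (T : measurableType d') (mu : {measure set T -> \bar R})
    (g : T -> R) (x : R) :
  mu [set: T] = 1%E -> bmeas g -> 0 < x -> (forall t, x <= g t) ->
  0 < \int[mu]_t g t.
Proof.
move=> mu1 bg x0 xg; rewrite (lt_le_trans x0)// -[leLHS](mean_cst mu1).
by apply: (le_mean mu1) => //; exact: bmeas_cst.
Qed.

Let prob1 d' (T : measurableType d') (mu : probability T R) : mu [set: T] = 1%E.
Proof. exact: probability_setT. Qed.

Lemma norm_back_le m k (t : k.+1.-tuple E) : `|back f m t| <= back path_one m t.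
Proof.
have l1 := @lin f 1 1 m k t bf; have l2 := @lin f (-1) 1 m k t bf.
have g1 : 0 <= back (fun k t => 1 * f t + 1 * path_one t) m t.
  by apply: back_ge0 => e _ u; have := f_le1 u; rewrite ler_norml /path_one => /andP[]; lra.
have g2 : 0 <= back (fun k t => (-1) * f t + 1 * path_one t) m t.
  by apply: back_ge0 => e _ u; have := f_le1 u; rewrite ler_norml /path_one => /andP[]; lra.
rewrite l1 in g1; rewrite l2 in g2.
by rewrite ler_norml; apply/andP; split; lra.
Qed.

Lemma mean_back1_gt0 m k (mu : probability (k.+1.-tuple E) R) :
  0 < \int[mu]_t back path_one m t.
Proof.
by have [x x0 xle] := back1_gt0 m k; exact: (mean_gt0 (prob1 mu) (bback1 m k) x0 xle).
Qed.

Lemma norm_filter_ratio m k (mu : probability (k.+1.-tuple E) R) :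
  `|filter_ratio m mu| <= 1.
Proof.
have u0 := mean_back1_gt0 m mu.
rewrite /filter_ratio normrM normfV (gtr0_norm u0) ler_pdivrMr// mul1r.
apply: (norm_mean_le (prob1 mu)); [exact: bbackf|exact: bback1|].
by move=> t; exact: norm_back_le.
Qed.

Lemma bmeas_filter_ratio m k :
  bmeas (fun mu : pprobability (k.+1.-tuple E) R => filter_ratio m mu).
Proof.
split; last by exists 1 => mu; exact: norm_filter_ratio.
have bm (g : k.+1.-tuple E -> R) : bmeas g ->
    bmeas (fun mu : pprobability (k.+1.-tuple E) R =>
      \int[mu : probability _ R]_t g t).
  move=> bg; apply: (bmeas_mean (k := fun mu : pprobability (k.+1.-tuple E) R =>
    (mu : probability _ R))) => //.
    by move=> A mA; exact: measurable_pprobability_eval.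
  by move=> mu; exact: probability_setT.
apply: measurable_funM; first exact: (bm _ (bbackf m k)).1.
(* The denominators are positive, so their inverse is the real power [-1], a measurable function. *)
rewrite (_ : (fun mu => _) = (fun x : R => x `^ (-1)) \o
    (fun mu : pprobability (k.+1.-tuple E) R =>
      \int[mu : probability _ R]_t back path_one m t)); last first.
  by apply/funext => mu /=; rewrite powR_inv1// ltW// mean_back1_gt0.
by apply: measurableT_comp; [exact: measurable_powR|exact: (bm _ (bback1 m k)).1].
Qed.

Variable Psi : forall k, potential (k.+1.-tuple E) R.
Variable eta : nat -> R.
Hypothesis Psi_ge : forall k, (0 < k)%N -> forall t, (a k)^-1 <= Psi k t.
Hypothesis Psi_le : forall k, (0 < k)%N -> forall t, Psi k t <= b k.
Hypothesis Psi_near : forall k, (0 < k)%N -> forall t : k.+1.-tuple E,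
  `|Psi k t - Psit t| <= eta k * Psi k t.

Let ainv_gt0 k : (0 < k)%N -> 0 < (a k)^-1.
Proof. by move=> k0; rewrite invr_gt0 (lt_le_trans ltr01)// a_ge1. Qed.

Let bPsi k : (0 < k)%N -> bmeas (Psi k).
Proof.
move=> k0; split; first exact: measurable_potential.
by exists (b k) => t; rewrite gtr0_norm ?potential_gt0// Psi_le.
Qed.

Definition osc_bound m i := \prod_(0 <= j < m %/ p) rho (i + j * p).

Let osc_bound_ge0 m i : 0 <= osc_bound m i.
Proof. by apply: prodr_ge0 => j _; exact: rho_ge0. Qed.

(** * Errors of a single step: truncation and sampling *)

Section local.
Variables (k m : nat) (mu : probability (k.+1.-tuple E) R).

Let nu : probability (k.+2.-tuple E) R := kact mu (path_kernel (Q k.+1) k).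
Let nu1 : nu [set: _] = 1%E := probability_setT nu.

Let Uk (t : k.+2.-tuple E) := back path_one m t.
Let Vk (t : k.+2.-tuple E) := back f m t.
Let r := osc_bound m k.+1.

(** The first truncated step is written as an integral against [nu], so that it can be compared with
    a step using [Psi] under the same measure. *)
Lemma filter_ratioS : filter_ratio m.+1 mu =
  (\int[nu]_t (Psit t * Vk t)) / \int[nu]_t (Psit t * Uk t).
Proof.
rewrite /filter_ratio !(mean_kact_path_kernel (Q k.+1) (prob1 mu))//.
  by apply: bmeasM; [exact: bPsit|exact: bback1].
by apply: bmeasM; [exact: bPsit|exact: bbackf].
Qed.

(** The normalizing constant of the weights cancels. *)
Lemma filter_ratio_boltzmann_gibbs (P : {measure set (k.+2.-tuple E) -> \bar R}) :
  P [set: _] = 1%E ->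
  filter_ratio m (boltzmann_gibbs (Psi k.+1) P) =
  (\int[P]_t (Psi k.+1 t * Vk t)) / \int[P]_t (Psi k.+1 t * Uk t).
Proof.
move=> P1; have k0 : (0 < k.+1)%N by [].
have Z0 := mean_gt0 P1 (bPsi k0) (ainv_gt0 k0) (Psi_ge k0).
rewrite /filter_ratio !(mean_boltzmann_gibbs P1 (bPsi k0) (ainv_gt0 k0) (Psi_ge k0))//.
by rewrite invfM invrK mulrACA mulVf ?mulr1// gt_eqF.
Qed.

Let bPU : bmeas (fun t => Psi k.+1 t * Uk t).
Proof. by apply: bmeasM; [exact: bPsi|exact: bback1]. Qed.

Let bPV : bmeas (fun t => Psi k.+1 t * Vk t).
Proof. by apply: bmeasM; [exact: bPsi|exact: bbackf]. Qed.

Let bPtU : bmeas (fun t => Psit t * Uk t).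
Proof. by apply: bmeasM; [exact: bPsit|exact: bback1]. Qed.

Let bPtV : bmeas (fun t => Psit t * Vk t).
Proof. by apply: bmeasM; [exact: bPsit|exact: bbackf]. Qed.

Let PU_gt0 (P : {measure set (k.+2.-tuple E) -> \bar R}) :
  P [set: _] = 1%E -> 0 < \int[P]_t (Psi k.+1 t * Uk t).
Proof.
move=> P1; have [x x0 xle] := back1_gt0 m k.+1.
apply: (mean_gt0 (x := (a k.+1)^-1 * x) P1 bPU).
  by rewrite mulr_gt0// ainv_gt0.
by move=> t; apply: ler_pM; [exact/ltW/ainv_gt0|exact: ltW|exact: Psi_ge|exact: xle].
Qed.

Let PtU_gt0 : 0 < \int[nu]_t (Psit t * Uk t).
Proof.
have [x x0 xle] := back1_gt0 m k.+1.
apply: (mean_gt0 (x := (a k.+1)^-1 * x) nu1 bPtU).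
  by rewrite mulr_gt0// ainv_gt0.
by move=> t; apply: ler_pM; [exact/ltW/ainv_gt0|exact: ltW|exact: Psit_ge|exact: xle].
Qed.

(** With the centre from [back_center], the centred numerators differ by at most [eta k.+1 * r * Y]
    and the denominators by [eta k.+1 * Y]; each contributes one [eta k.+1 * r] through
    [ratio_diff_le]. *)
Lemma truncation_error :
  `|filter_ratio m (boltzmann_gibbs (Psi k.+1) nu) - filter_ratio m.+1 mu| <=
  2 * eta k.+1 * r.
Proof.
have [al alP] := back_center m k.+1.
rewrite filter_ratioS (filter_ratio_boltzmann_gibbs nu1).
set Y := \int[nu]_t (Psi k.+1 t * Uk t).
have Y0 : 0 < Y by exact: PU_gt0.
have rU (t : k.+2.-tuple E) : 0 <= r * Uk t.
  by rewrite mulr_ge0//; [exact: osc_bound_ge0|rewrite ltW//; exact: U_gt0].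
apply: le_trans (ratio_diff_le (al := al) (d1 := eta k.+1 * r * Y) (d2 := eta k.+1 * Y)
  (r := r) Y0 PtU_gt0 (osc_bound_ge0 _ _) _ _ _) _.
- rewrite -!(meanZ nu1)// -!(meanB nu1)//; last 4 first.
  + by apply: bmeasB => //; exact: bmeasZ.
  + by apply: bmeasB => //; exact: bmeasZ.
  + exact: bmeasZ.
  + exact: bmeasZ.
  apply: (norm_mean_le nu1).
  + by apply: bmeasB; apply: bmeasB => //; exact: bmeasZ.
  + exact: bmeasZ.
  move=> t; rewrite (_ : _ - _ = (Psi k.+1 t - Psit t) * (Vk t - al * Uk t)); last by ring.
  rewrite normrM (_ : _ * _ * _ = (eta k.+1 * Psi k.+1 t) * (r * Uk t)); last by ring.
  by rewrite ler_pM// ?Psi_near//; exact: alP.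
- rewrite -!(meanZ nu1)// -!(meanB nu1)//.
  apply: (norm_mean_le nu1); [exact: bmeasB|exact: bmeasZ|].
  move=> t; rewrite -mulrBl normrM (gtr0_norm (U_gt0 m t)) mulrA.
  by rewrite ler_wpM2r ?Psi_near// ltW//; exact: U_gt0.
- rewrite -!(meanZ nu1)// -!(meanB nu1)//; last exact: bmeasZ.
  apply: (norm_mean_le nu1); [by apply: bmeasB => //; exact: bmeasZ|exact: bmeasZ|].
  move=> t; rewrite (_ : _ - _ = Psit t * (Vk t - al * Uk t)); last by ring.
  rewrite normrM (gtr0_norm (Psit_pos t)) mulrCA.
  by rewrite ler_wpM2l// ?(ltW (Psit_pos t))//; exact: alP.
rewrite ler_pdivrMr// le_eqVlt; apply/orP; left; apply/eqP; ring.
Qed.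

(** Monte Carlo errors scale with the supremum of the integrand, while the denominator is a mean;
    passing from one to the other costs only [kappa]. *)
Let U_le_mean (t : k.+2.-tuple E) : Uk t <= kappa k.+1 * \int[nu]_u Uk u.
Proof.
rewrite -[leLHS](mean_cst nu1) -(meanZ nu1)//; last exact: bback1.
apply: (le_mean nu1); [exact: bmeas_cst|by apply: bmeasZ; exact: bback1|].
by move=> u; exact: back1_kappa.
Qed.

(** Sampling perturbs the centred numerator [h1], bounded by [r * M], and the denominator [h2],
    bounded by [M]. The constant comes from [M / Y <= kappa * a * b] at time [k.+1]. *)
Lemma sampling_error N : (0 < N)%N ->
  \int[iid nu N]_z `|filter_ratio m (boltzmann_gibbs (Psi k.+1) (empirical R z))
    - filter_ratio m.+1 mu| <=
  2 * eta k.+1 * r + 2 * r * (kappa k.+1 * (a k.+1 * b k.+1)) / Num.sqrt N%:R.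
Proof.
move=> N0; have k0 : (0 < k.+1)%N by [].
have iid1 : iid nu N [set: _] = 1%E by exact: probability_setT.
have [al alP] := back_center m k.+1.
set Y := \int[nu]_t (Psi k.+1 t * Uk t).
have Y0 : 0 < Y by exact: PU_gt0.
pose h1 t := Psi k.+1 t * (Vk t - al * Uk t).
pose h2 t := Psi k.+1 t * Uk t.
have bh1 : bmeas h1.
  apply: bmeasM; first exact: bPsi.
  by apply: bmeasB; [exact: bbackf|apply: bmeasZ; exact: bback1].
have r0 : 0 <= r by exact: osc_bound_ge0.
set M := b k.+1 * (kappa k.+1 * \int[nu]_u Uk u).
have b0 : 0 <= b k.+1 by rewrite (le_trans ler01)// b_ge1.
have M0 : 0 <= M.
  rewrite mulr_ge0// mulr_ge0//; first by rewrite (le_trans ler01)// kappa_ge1.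
  by rewrite ltW//; exact: mean_back1_gt0.
have h2M t : `|h2 t| <= M.
  rewrite /h2 normrM (gtr0_norm (potential_gt0 _ _)) (gtr0_norm (U_gt0 m t)).
  by apply: ler_pM; [exact/ltW/potential_gt0|exact/ltW/U_gt0|exact: Psi_le|exact: U_le_mean].
have h1M t : `|h1 t| <= r * M.
  rewrite /h1 normrM (gtr0_norm (potential_gt0 _ _)) /M mulrCA.
  apply: ler_pM => //; [exact/ltW/potential_gt0|exact: Psi_le|].
  by apply: le_trans (alP t) _; apply: ler_wpM2l => //; exact: U_le_mean.
pose e1 (z : N.-tuple (k.+2.-tuple E)) : R := `|\int[empirical R z]_x h1 x - \int[nu]_x h1 x|.
pose e2 (z : N.-tuple (k.+2.-tuple E)) : R := `|\int[empirical R z]_x h2 x - \int[nu]_x h2 x|.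
have bemp (h : k.+2.-tuple E -> R) : bmeas h ->
    bmeas (fun z : N.-tuple (k.+2.-tuple E) =>
      `|\int[empirical R z]_x h x - \int[nu]_x h x|).
  move=> bh; apply: bmeas_norm; apply: bmeasB; last exact: bmeas_cst.
  apply: bmeas_mean => // [A mA|z]; first exact: measurable_empirical.
  exact: empirical_setT.
have be1 : bmeas e1 by exact: bemp.
have be2 : bmeas e2 by exact: bemp.
have bratio : bmeas (fun z : N.-tuple (k.+2.-tuple E) =>
    filter_ratio m (boltzmann_gibbs (Psi k.+1) (empirical R z))).
  exact: (bmeas_comp (@measurable_weighted_empirical _ _ _ (Psi k.+1) N)
    (bmeas_filter_ratio m k.+1)).
apply: (@le_trans _ _ (\int[iid nu N]_z
    (2 * eta k.+1 * r + (Y^-1 * e1 z + (Y^-1 * r) * e2 z)))).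
  apply: (le_mean iid1).
  - by apply: bmeas_norm; apply: bmeasB => //; exact: bmeas_cst.
  - apply: bmeasD; first exact: bmeas_cst.
    by apply: bmeasD; exact: bmeasZ.
  move=> z; have S1 := empirical_setT R N0 z.
  (* The exact reweighting of [nu] is inserted between the sampled and the truncated step. *)
  apply: le_trans (ler_distD
    (filter_ratio m (boltzmann_gibbs (Psi k.+1) nu)) _ _) _.
  rewrite addrC lerD ?truncation_error//.
  rewrite (filter_ratio_boltzmann_gibbs nu1) (filter_ratio_boltzmann_gibbs S1) distrC.
  have -> : Y^-1 * e1 z + Y^-1 * r * e2 z = (e1 z + r * e2 z) / Y by ring.
  (* The ratios are ordered so that the deterministic [Y], not the random denominator, divides the
     errors; the bound is then linear in [e1] and [e2]. *)
  apply: (ratio_diff_le (al := al)) => //.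
  - exact: PU_gt0.
  - rewrite -!(meanZ nu1)// -!(meanZ S1)// -!(meanB nu1)// -?(meanB S1)//; last 2 first.
    + exact: bmeasZ.
    + exact: bmeasZ.
    rewrite distrC /e1 le_eqVlt; apply/orP; left; apply/eqP; congr `|_ - _|;
      by apply: eq_Rintegral => t _; rewrite /h1; ring.
  - by rewrite distrC.
  rewrite -!(meanZ S1)// -!(meanB S1)//; last exact: bmeasZ.
  apply: (norm_mean_le S1); [by apply: bmeasB => //; exact: bmeasZ|exact: bmeasZ|].
  move=> t; rewrite (_ : _ - _ = h1 t); last by rewrite /h1; ring.
  rewrite normrM (gtr0_norm (potential_gt0 _ _)) mulrCA.
  by apply: ler_wpM2l; [exact/ltW/potential_gt0|exact: alP].
rewrite (meanD iid1); [|exact: bmeas_cst|by apply: bmeasD; exact: bmeasZ].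
rewrite (mean_cst iid1) lerD2l (meanD iid1); [|exact: bmeasZ|exact: bmeasZ].
rewrite !(meanZ iid1)//.
have s0 : 0 < Num.sqrt (N%:R : R) by rewrite sqrtr_gt0 ltr0n.
have E1 := monte_carlo nu N0 bh1 (mulr_ge0 r0 M0) h1M.
have E2 := monte_carlo nu N0 bPU M0 h2M.
have Yi0 : 0 <= Y^-1 by rewrite invr_ge0 ltW.
apply: (@le_trans _ _ (Y^-1 * (r * M / Num.sqrt N%:R) + Y^-1 * r * (M / Num.sqrt N%:R))).
  by apply: lerD; [exact: ler_wpM2l|apply: ler_wpM2l => //; exact: mulr_ge0].
have UY : \int[nu]_u Uk u <= a k.+1 * Y.
  rewrite -(meanZ nu1)//; apply: (le_mean nu1); [exact: bback1|exact: bmeasZ|].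
  move=> t; rewrite mulrA ler_peMl//; first by rewrite ltW// U_gt0.
  by rewrite -ler_pdivrMl ?mulr1 ?Psi_ge// (lt_le_trans ltr01)// a_ge1.
have -> : Y^-1 * (r * M / Num.sqrt N%:R) + Y^-1 * r * (M / Num.sqrt N%:R) =
    2 * r * (M / Y) / Num.sqrt N%:R by field; rewrite !gt_eqF.
apply: ler_wpM2r; first by rewrite invr_ge0 ltW.
apply: ler_wpM2l; first exact: mulr_ge0.
rewrite ler_pdivrMr// /M.
have -> : kappa k.+1 * (a k.+1 * b k.+1) * Y =
    b k.+1 * (kappa k.+1 * (a k.+1 * Y)) by ring.
apply: ler_wpM2l => //; apply: ler_wpM2l => //.
by rewrite (le_trans ler01) ?kappa_ge1.
Qed.

End local.

(** * Telescoping over time *)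

Variable zeta : probability E R.
Let opt := optimal_filter Q zeta Psi.

Lemma optimal_filter_telescope n k : (k <= n)%N ->
  `|filter_ratio (n - k) (opt k) - filter_ratio n (opt 0)| <=
  \sum_(1 <= i < k.+1) 2 * eta i * osc_bound (n - i) i.
Proof.
elim: k => [_|k IH kn]; first by rewrite subn0 subrr normr0 big_geq.
rewrite big_nat_recr//= addrC.
apply: le_trans (ler_distD (filter_ratio (n - k) (opt k)) _ _) _.
apply: lerD; last exact: IH (ltnW kn).
(* A step of [opt] unfolds to [boltzmann_gibbs] of the extended path law. *)
by rewrite -(subnSK kn); exact: truncation_error.
Qed.

(** Conditioning on the random measure at time [k], the fresh sample is averaged first; the bound
    [D] on its error is the same for every value of that measure. *)
Lemma particle_telescope n N k : (0 < N)%N -> (k <= n)%N ->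
  \int[particle_law Q zeta Psi N k]_mu
    `|filter_ratio (n - k) mu - filter_ratio n (opt 0)| <=
  \sum_(1 <= i < k.+1) (2 * eta i * osc_bound (n - i) i +
    2 * osc_bound (n - i) i * (kappa i * (a i * b i)) / Num.sqrt N%:R).
Proof.
move=> N0; elim: k => [_|k IH kn].
  rewrite big_geq// /Rintegral integral_dirac//; last first.
    apply/measurable_EFinP/measurableT_comp => //; apply: measurable_funB => //.
    exact: (bmeas_filter_ratio _ _).1.
  by rewrite diracT mul1e subn0 subrr normr0.
set x0 := filter_ratio n (opt 0).
have babs m j (y : R) :
    bmeas (fun mu : pprobability (j.+1.-tuple E) R => `|filter_ratio m mu - y|).
  apply: bmeas_norm; apply: bmeasB; last exact: bmeas_cst.
  exact: bmeas_filter_ratio.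
set D := 2 * eta k.+1 * osc_bound (n - k.+1) k.+1 +
  2 * osc_bound (n - k.+1) k.+1 * (kappa k.+1 * (a k.+1 * b k.+1)) / Num.sqrt N%:R.
have P1 := probability_setT (particle_law Q zeta Psi N k).
rewrite big_nat_recr//= addrC -/D.
rewrite (mean_mixture (mu := particle_law Q zeta Psi N k)
  (k := particle_kernel (Q k.+1) (Psi k.+1) N))//; last 2 first.
- by move=> mu; exact: prob_kernel.
- by move=> A mA; exact: measurable_kernel.
apply: (@le_trans _ _ (\int[particle_law Q zeta Psi N k]_mu
    (D + `|filter_ratio (n - k) mu - x0|))); last first.
  rewrite (meanD P1)//; last exact: bmeas_cst.
  by rewrite (mean_cst P1) lerD2l; exact: IH (ltnW kn).
apply: (le_mean P1).
- apply: bmeas_mean => //; first by move=> A mA; exact: measurable_kernel.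
  by move=> mu; exact: prob_kernel.
- by apply: bmeasD; [exact: bmeas_cst|].
move=> mu; set nu := kact (mu : probability _ R) (path_kernel (Q k.+1) k).
have iid1 : iid nu N [set: _] = 1%E by exact: probability_setT.
have mwe := @measurable_weighted_empirical _ _ R (Psi k.+1) N.
have bwe y : bmeas (fun z : N.-tuple (k.+2.-tuple E) =>
    `|filter_ratio (n - k.+1) (weighted_empirical (Psi k.+1) z) - y|).
  exact: (bmeas_comp mwe (babs _ _ y)).
rewrite (_ : Rintegral _ _ _ = \int[iid nu N]_z
    `|filter_ratio (n - k.+1) (weighted_empirical (Psi k.+1) z) - x0|); last first.
  rewrite /Rintegral /particle_kernel integral_distribution//.
    by apply/measurable_EFinP; exact: (babs _ _ x0).1.
  exact: (bmeas_integrable iid1).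
apply: (@le_trans _ _ (\int[iid nu N]_z
    (`|filter_ratio (n - k.+1) (weighted_empirical (Psi k.+1) z) -
       filter_ratio (n - k) mu| + `|filter_ratio (n - k) mu - x0|))).
  apply: (le_mean iid1) => //.
    by apply: bmeasD; [exact: bwe|exact: bmeas_cst].
  by move=> z; exact: ler_distD.
rewrite (meanD iid1)//; last exact: bmeas_cst.
rewrite (mean_cst iid1) lerD2r /D -(subnSK kn).
exact: sampling_error.
Qed.

(** Both filters are compared with the truncated filter started from [zeta], whose mean is [x0]. The
    truncation error is therefore paid twice, whence [4 * eta i]. *)
Lemma filter_error n N : (0 < N)%N ->
  \int[particle_law Q zeta Psi N n]_mu
    `|\int[opt n]_t f t - \int[mu : probability _ R]_t f t| <=
  \sum_(1 <= i < n.+1) osc_bound (n - i) i *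
    (4 * eta i + 2 * (kappa i * (a i * b i)) / Num.sqrt N%:R).
Proof.
move=> N0; have P1 := probability_setT (particle_law Q zeta Psi N n).
have ratio0 (mu : probability (n.+1.-tuple E) R) :
    filter_ratio (n - n) mu = \int[mu]_t f t.
  by rewrite /filter_ratio subnn /= (mean_cst (prob1 mu)) divr1.
have H1 := optimal_filter_telescope (leqnn n).
have H2 := particle_telescope N0 (leqnn n).
set x0 := filter_ratio n (opt 0) in H1 H2.
have bd j (y : R) : bmeas (fun mu : pprobability (n.+1.-tuple E) R =>
    `|filter_ratio j mu - y|).
  apply: bmeas_norm; apply: bmeasB; last exact: bmeas_cst.
  exact: bmeas_filter_ratio.
rewrite (_ : \sum_(_ <= _ < _) _ =
  \sum_(1 <= i < n.+1) 2 * eta i * osc_bound (n - i) i +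
  \sum_(1 <= i < n.+1) (2 * eta i * osc_bound (n - i) i +
    2 * osc_bound (n - i) i * (kappa i * (a i * b i)) / Num.sqrt N%:R)); last first.
  by rewrite -big_split; apply: eq_bigr => i _ /=; ring.
apply: le_trans (lerD H1 H2).
rewrite -[X in X + _](mean_cst P1) -(meanD P1)//; last exact: bmeas_cst.
apply: (le_mean P1).
- under eq_fun do rewrite distrC -ratio0 -(ratio0 (opt n)).
  exact: bd.
- by apply: bmeasD => //; exact: bmeas_cst.
move=> mu; rewrite -!ratio0 [X in _ <= _ + X]distrC.
exact: ler_distD.
Qed.

End oscillation.

End backward.

(** * Truncated functions, constants and the final bound *)

Section truncation.
Context d (E : measurableType d).

Lemma tuple_tail_agree p i k (t t' : k.+1.-tuple E) :
  (i + p <= k)%N -> agree i t t' -> tuple_tail p t = tuple_tail p t'.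
Proof.
move=> ipk tt'; apply: eq_from_tnth => j; rewrite !tnth_mktuple !(tnth_nth point).
have pk : (p <= k.+1)%N by rewrite leqW// (leq_trans _ ipk)// leq_addl.
have ij : (i.+1 <= k.+1 - minn k.+1 p + j)%N.
  by rewrite (leq_trans _ (leq_addr _ _))// (minn_idPr pk) ltn_subRL addnC ltnS.
have := congr1 (nth point ^~ (k.+1 - minn k.+1 p + j - i.+1)%N) tt'.
by rewrite !nth_drop subnKC.
Qed.

(** Reading a function of fixed arity [m] at every time [k], with [point] in place of missing
    states, turns it into a [pathfun]. *)
Lemma bmeas_nth_tail (R : realType) p k m (f : m.-tuple E -> R) : bmeas f ->
  bmeas (fun t : k.+1.-tuple E =>
    f [tuple nth point (tuple_tail p t) i | i < m]).
Proof.
apply: (bmeas_comp (h := fun t : k.+1.-tuple E =>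
  [tuple nth point (tuple_tail p t) i | i < m])).
apply/measurable_fun_tnthP => i.
have [ik|ki] := ltnP i (minn k.+1 p).
  rewrite (_ : _ \o _ = (fun t => tnth t (Ordinal ik)) \o @tuple_tail _ E k.+1 p).
    exact: measurableT_comp (measurable_tnth _) (@measurable_tuple_tail _ _ _ _).
  by apply/funext => t /=; rewrite tnth_mktuple (tnth_nth point).
rewrite (_ : _ \o _ = cst point); first exact: measurable_cst.
by apply/funext => t /=; rewrite tnth_mktuple nth_default ?size_tuple ?card_ord.
Qed.

End truncation.

Lemma mixing_ratio d (E : measurableType d) (R : realType)
    (Q : nat -> R.-pker E ~> E) (eps : nat -> R) : mixing Q eps ->
  forall k, (0 < k)%N -> forall x x' A, measurable A ->
  (Q k x A <= ((eps k)^-1 ^+ 2)%:E * Q k x' A)%E.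
Proof.
move=> mix k k0 x x' A mA; have [/andP[e0 _] [xi xiP]] := mix k k0.
have [_ /le_trans] := xiP x A mA; apply.
have [le1 _] := xiP x' A mA.
have -> : (((eps k)^-1)%:E * xi A =
    ((eps k)^-1 ^+ 2)%:E * ((eps k)%:E * xi A))%E.
  by rewrite muleA -EFinM expr2 -mulrA mulVf ?mulr1// gt_eqF.
by apply: lee_wpmul2l => //; rewrite lee_fin sqr_ge0.
Qed.

Section constants.
Variables (R : realType) (eps a b : nat -> R) (p : nat).
Let c k := (eps k)^-1 ^+ 2.

Lemma kappaE i : kappa a b p c i = (eps_tilde2 eps a b (i + 1) p)^-1.
Proof.
rewrite /kappa /eps_tilde2 invf_div -big_split/= mulrC /c exprVn addn1.
by rewrite addSn subn1.
Qed.

Lemma rhoE i : 1 <= kappa a b p c i ->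
  rho a b p c i = rho_tilde eps a b (i + 1) p.
Proof.
rewrite /rho /rho_tilde -[eps_tilde2 _ _ _ _ _]invrK -kappaE => k1.
have k0 : 0 < kappa a b p c i by rewrite (lt_le_trans ltr01).
by field; rewrite !gt_eqF// addr_gt0.
Qed.

End constants.

Lemma prod_drop_le (R : realFieldType) (F : nat -> R) (n m : nat) :
  (forall j, 0 <= F j <= 1) ->
  \prod_(0 <= j < m) F j <= \prod_(n <= j < m) F j.
Proof.
move=> F01; have [nm|mn] := leqP n m.
  rewrite (@big_cat_nat _ _ _ n)//= ler_piMl//.
    by apply: prodr_ge0 => j _; have /andP[] := F01 j.
  by apply: prodr_ile1 => j _; exact: F01.
rewrite [leRHS]big_geq; last exact: ltnW.
by apply: prodr_ile1 => j _; exact: F01.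
Qed.

(** From [ln (1 + x) <= x] one gets [ln 3 <= 2], so the prefactor is at least [2]; then [4 * eta + 2
    * k * x <= 2 * (3 * eta + 4 * x) * k] suffices. *)
Lemma error_term_le (R : realType) (r r' eta x k k' : R) :
  0 <= r <= r' -> 0 <= eta -> 0 <= x -> 1 <= k -> 1 <= k' ->
  r * (4 * eta + 2 * k * x) <= 4 / ln 3 * ((3 * eta + 4 * x) * (k * k') * r').
Proof.
move=> /andP[r0 rr'] eta0 x0 k1 k'1.
have l0 : 0 < ln (3 : R) by apply: ln_gt0; lra.
have l2 : ln (3 : R) <= 2.
  by rewrite (_ : 3 = 1 + 2 :> R); [apply: le_ln1Dx; lra|ring].
have h2 : 2 <= 4 / ln (3 : R) by rewrite ler_pdivlMr//; lra.
have k0 : 0 <= k by exact: le_trans k1.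
have r'0 : 0 <= r' by exact: le_trans rr'.
have s0 : 0 <= 3 * eta + 4 * x by lra.
have kk : k <= k * k' by rewrite ler_peMr.
apply: (@le_trans _ _ (2 * ((3 * eta + 4 * x) * k * r'))); last first.
  apply: ler_pM => //; first by rewrite !mulr_ge0.
  by apply: ler_wpM2r => //; apply: ler_wpM2l.
apply: (@le_trans _ _ (r' * (4 * eta + 2 * k * x))).
  by apply: ler_wpM2r => //; rewrite addr_ge0 ?mulr_ge0.
rewrite [leRHS](_ : _ = r' * (2 * ((3 * eta + 4 * x) * k))); last by ring.
apply: ler_wpM2l => //.
have ek : eta <= eta * k by rewrite ler_peMr.
have xk : 0 <= k * x by exact: mulr_ge0.
nra.
Qed.

Theorem theorem7 (R : realType) (E : completeMetricType R)
    (sepE : separable_space E)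
    (Q : nat -> R.-pker (borel E) ~> (borel E))
    (zeta : probability (borel E) R)
    (Psi : forall n : nat, potential (n.+1.-tuple (borel E)) R)
    (p : nat) (p_ge2 : (2 <= p)%N)
    (Psit : forall n : nat, (minn n.+1 p).-tuple (borel E) -> R)
    (eps a b phi : nat -> R) (tau : R)
    (hyp1 : mixing Q eps)
    (hyp2 : truncated_potentials Psi Psit phi tau)
    (hyp3 : bounded_potentials Psi Psit a b)
    (N n : nat) (N_ge1 : (1 <= N)%N) (n_ge1 : (1 <= n)%N) :
  (particle_error Q zeta Psi N p n <=
   (4 / ln 3 * \sum_(1 <= i < n.+1)
      local_error a b phi tau N p i /
        (eps_tilde2 eps a b (i + 1) p * eps_tilde2 eps a b (i + p + 1) p) *
      \prod_(2 <= j < (n - i) %/ p) rho_tilde eps a b (i + j * p + 1) p)%:E)%E.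
Proof.
have [/andP[tau0 tau1] phi0 Psit_small Psit_large] := hyp2.
have p0 : (0 < p)%N by rewrite ltnW.
pose c k := (eps k)^-1 ^+ 2.
have c1 k : (0 < k)%N -> 1 <= c k.
  move=> k0; have [/andP[e0 e1] _] := hyp1 k k0.
  by rewrite /c expr_ge1 ?invr_ge0 ?invf_ge1// ltW.
have Qc : forall k, (0 < k)%N -> forall x x' A, measurable A ->
  (Q k x A <= (c k)%:E * Q k x' A)%E by exact: mixing_ratio hyp1.
have a1 k : (0 < k)%N -> 1 <= a k by move=> k0; have [] := hyp3 k k0.
have b1 k : (0 < k)%N -> 1 <= b k by move=> k0; have [] := hyp3 k k0.
pose Pt k (t : k.+1.-tuple (borel E)) := Psit k (tuple_tail p t).
have Pt_ge k : (0 < k)%N -> forall t, (a k)^-1 <= Pt k t.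
  by move=> k0 t; have [_ _ /(_ t)[_ /andP[]]] := hyp3 k k0.
have Pt_le k : (0 < k)%N -> forall t, Pt k t <= b k.
  by move=> k0 t; have [_ _ /(_ t)[_ /andP[]]] := hyp3 k k0.
have Psi_ge k : (0 < k)%N -> forall t, (a k)^-1 <= Psi k t.
  by move=> k0 t; have [_ _ /(_ t)[/andP[]]] := hyp3 k k0.
have Psi_le k : (0 < k)%N -> forall t, Psi k t <= b k.
  by move=> k0 t; have [_ _ /(_ t)[/andP[]]] := hyp3 k k0.
have bPt k : (0 < k)%N -> bmeas (Pt k).
  move=> k0; split; last first.
    exists (b k) => t; rewrite ger0_norm ?Pt_le//.
    by apply: le_trans (Pt_ge k k0 t); rewrite invr_ge0 (le_trans ler01)// a1.
  have [kp|pk] := ltnP k p.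
    rewrite (_ : Pt k = Psi k); first exact: measurable_potential.
    by apply/funext => t; rewrite /Pt Psit_small// k0.
  have [mPsit _] := Psit_large k pk.
  exact: measurableT_comp mPsit (@measurable_tuple_tail _ _ _ _).
have tailPt i k : (i + p <= k)%N -> forall t t' : k.+1.-tuple (borel E),
    agree i t t' -> Pt k t = Pt k t'.
  by move=> ipk t t' tt'; rewrite /Pt (tuple_tail_agree ipk tt').
pose eta k := phi k * tau ^+ p.
have eta0 k : (0 < k)%N -> 0 <= eta k.
  by move=> k0; rewrite mulr_ge0 ?exprn_ge0// ltW// phi0.
have Psi_near k : (0 < k)%N -> forall t : k.+1.-tuple (borel E),
    `|Psi k t - Pt k t| <= eta k * Psi k t.
  (* For [k < p] the truncated potential is [Psi k] itself and the error vanishes. *)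
  move=> k0 t; have [kp|pk] := ltnP k p.
    rewrite /Pt Psit_small ?k0// subrr normr0 mulr_ge0 ?eta0//.
    by rewrite ltW// potential_gt0.
  have [_ /(_ t) /le_trans] := Psit_large k pk; apply.
  by apply: ler_wpM2l; [exact: eta0|rewrite ge_min lexx].
apply: ge_ereal_sup => _ [f [mf f1] <-].
have fle x : `|f x| <= 1.
  by rewrite -lee_fin -f1; apply: ereal_sup_ubound; exists x.
have bf : bmeas f by split => //; exists 1.
(* Only the values at time [n] enter the final bound, and there [g] is [f] on the tail ([gE]); at
   other times the arguments are padded or cut. *)
pose g : pathfun (borel E) R := fun k t =>
  f [tuple nth point (tuple_tail p t) i | i < minn n.+1 p].
have bg k : bmeas (g k) by exact: bmeas_nth_tail.
have g1 k t : `|g k t| <= 1 by exact: fle.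
have tg : tailfun p g.
  by move=> i k ipk t t' tt'; rewrite /g (tuple_tail_agree ipk tt').
have gE t : g n t = f (tuple_tail p t).
  congr f; apply: eq_from_tnth => i.
  by rewrite tnth_mktuple -(tnth_nth point).
have marg (mu : probability (n.+1.-tuple (borel E)) R) :
    (\int[marginal p mu]_x (f x)%:E = (\int[mu]_t g n t)%:E)%E.
  rewrite (EFin_mean (probability_setT mu)); last exact: bg.
  rewrite [LHS](integral_distribution (P := mu) (X := @tuple_tail _ _ n.+1 p))//.
  - by apply: eq_integral => t _; rewrite gE.
  - exact/measurable_EFinP.
  - rewrite (_ : _ \o _ = EFin \o g n); last by apply/funext => t /=; rewrite gE.
    exact: (bmeas_integrable (probability_setT mu) (bg n)).
under eq_integral do rewrite !marg -EFinB abse_EFin.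
have kap1 i : 1 <= kappa a b p c i by exact: kappa_ge1.
have P1 := probability_setT (particle_law Q zeta Psi N n).
rewrite -(EFin_mean P1); last first.
  apply: bmeas_norm; apply: bmeasB; first exact: bmeas_cst.
  apply: (bmeas_mean (k := fun mu : pprobability (n.+1.-tuple (borel E)) R =>
    (mu : probability _ R))); last exact: bg.
    by move=> A mA; exact: measurable_pprobability_eval.
  by move=> mu; exact: probability_setT.
rewrite lee_fin.
apply: le_trans (filter_error bPt a1 b1 Pt_ge Pt_le p0 c1 Qc tailPt bg g1 tg
  Psi_ge Psi_le Psi_near zeta n N_ge1) _.
rewrite mulr_sumr big_nat_cond [leRHS]big_nat_cond.
apply: ler_sum => i /andP[/andP[i0 _] _].
rewrite /local_error invfM -!kappaE -/c.
have x0 : 0 <= a i * b i / Num.sqrt N%:R.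
  by rewrite !mulr_ge0 ?invr_ge0 ?sqrtr_ge0// (le_trans ler01)// ?a1 ?b1.
have r01 j : 0 <= rho a b p c (i + j * p) <= 1.
  by rewrite rho_ge0// rho_le1.
rewrite (_ : 3 * _ * _ + _ = 3 * eta i + 4 * (a i * b i / Num.sqrt N%:R)); last first.
  by rewrite /eta; ring.
rewrite (_ : 2 * _ / _ = 2 * kappa a b p c i * (a i * b i / Num.sqrt N%:R)); last first.
  by ring.
apply: error_term_le => //; last exact: eta0.
rewrite prodr_ge0/=; last by move=> j _; have /andP[] := r01 j.
(* The contraction product starts at [j = 0] and the stated one at [j = 2], with the same upper end;
   dropping factors at most one only increases it. *)
under [leRHS]eq_bigr do rewrite -rhoE//.
exact: prod_drop_le.
Qed.
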